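(* Let $\Phi_\tau$ be the numerical flow of a one-step method of order $p$ for the initial value problem $\frac{dy}{dt}=f(t,y)$, with exact flow $\varphi_\tau$, and let $y_n\in\mathbb{R}^d$ be the state at time $t_n$. Let $\gamma_1,\gamma_2\in\mathbb{C}$ satisfy $\gamma_1+\gamma_2=1$, and define the double composition $$\Psi_\tau := \Phi_{\gamma_2\tau}\circ\Phi_{\gamma_1\tau},\qquad \Psi_\tau(y_n)=\Phi_{\gamma_2\tau}\big(\Phi_{\gamma_1\tau}(y_n)\big)\in\mathbb{C}^d .$$ If $$\gamma_1^{p+1}+\gamma_2^{p+1}=0,$$ then there is a constant $\mathcal{C}$, independent of $\tau$, such that, as $\tau\to 0$, $$\big\|\varphi_\tau(y_n)-\operatorname{Re}\big(\Psi_\tau(y_n)\big)\big\| \sim \mathcal{C}\,\big\|\operatorname{Im}\big(\Psi_\tau(y_n)\big)\big\| .$$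
   Context: Setting. Consider the Cauchy problem $\frac{dy}{dt}=f(t,y)$, $y(t_0)=y_0$, where $y: I\subset\mathbb{R}\to U\subseteq\mathbb{R}^d$ and $f:I\times U\to\mathbb{R}^d$. It is assumed that $f$ extends naturally (holomorphically, so that Taylor expansions are available) to $J\times V$ with $I\subset J\subset\mathbb{C}$ and $U\subset V\subset\mathbb{C}^d$; this allows complex times, complex time steps and complex states. Exact flow. $\varphi_\tau(y_n)$ denotes the value at time $t_n+\tau$ of the exact solution of the differential equation that equals $y_n$ at time $t_n$. Numerical flow. A one-step method with time step $\tau$ has an associated map $\Phi_\tau$ with $y_{n+1}=\Phi_\tau(y_n)$, where $y_n$ is the state at time $t_n$ and $y_{n+1}$ approximates the solution at $t_n+\tau$. The method is of order $p$ if the local error is $O(\tau^{p+1})$; more precisely, for every state $y_n$ at time $t_n$, $$\Phi_\tau(y_n)=\varphi_\tau(y_n)+C_{p+1}\tau^{p+1}F_{p+1}(t_n,y_n)+C_{p+2}\tau^{p+2}F_{p+2}(t_n,y_n)+O(\tau^{p+3}),$$ where $C_{p+1},C_{p+2}$ are constants of the method and $F_{p+1},F_{p+2}$ are functions of $(t,y)$ expressed through $f$ and its derivatives. This relation is also used for complex states and for complex steps $\gamma\tau$, $\gamma\in\mathbb{C}$. Composition. In $\Psi_\tau(y_n)=\Phi_{\gamma_2\tau}(\Phi_{\gamma_1\tau}(y_n))$, the first step starts at time $t_n$ and the second step starts at time $t_n+\gamma_1\tau$, from the complex state $\Phi_{\gamma_1\tau}(y_n)$. $\operatorname{Re}$ and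 $\operatorname{Im}$ are taken componentwise, and $\|\cdot\|$ is the Euclidean norm. The symbol $\sim$ denotes asymptotic equivalence as $\tau\to0$.
   Formalization: Added: the order-(p+2) coefficients of the real and imaginary parts of the error of Ψ_τ(y_n) are nonzero (else false: explicit Euler, y'=y gives Im Ψ=0 but a nonzero error). The local-error remainder is O(τ^{p+3}) locally uniformly in (t,y), and the method constants are real. *)

(* Defs.v *)
From HB Require Import structures.
From mathcomp Require Import all_boot all_order all_algebra.
From mathcomp Require Import all_classical all_reals all_analysis.
From mathcomp Require Import complex.

Set Implicit Arguments.
Unset Strict Implicit.
Unset Printing Implicit Defensive.

Import Order.TTheory GRing.Theory Num.Theory.
Import numFieldNormedType.Exports.

Local Open Scope classical_set_scope.
Local Open Scope ring_scope.

(* mathcomp-analysis provides this structure for a variable numFieldType only,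
   not for the concrete type R[i]. *)
HB.instance Definition _ (R : realType) :=
  NormedModule.copy R[i] (R[i] : numFieldType)^o.

Section Vectors.
Context {R : realType} {d : nat}.

Definition cplx (x : 'rV[R]_d) : 'rV[R[i]]_d := map_mx (real_complex R) x.
Definition reV (z : 'rV[R[i]]_d) : 'rV[R]_d := map_mx (@complex.Re R) z.
Definition imV (z : 'rV[R[i]]_d) : 'rV[R]_d := map_mx (@complex.Im R) z.

(* Euclidean norm; the library norm `|z| on row vectors is the sup norm. *)
Definition enorm (z : 'rV[R[i]]_d) : R :=
  Num.sqrt (\sum_(k < d)
    (complex.Re (z ord0 k) ^+ 2 + complex.Im (z ord0 k) ^+ 2)).

End Vectors.

Section Ode.
Context {R : realType} {d : nat}.
Local Notation state := 'rV[R[i]]_d.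
Implicit Types (I : set R) (U : set 'rV[R]_d) (J : set R[i]) (V : set state)
  (F : R[i] * state -> state) (phi Phi : R[i] -> R[i] -> state -> state).

(* The scalars are R[i], so [differentiable] is complex Frechet
   differentiability, jointly in (t, y); a holomorphic map is one that is
   continuously differentiable in this sense. *)
Definition holomorphic_on (D : set (R[i] * state)) F : Prop :=
  forall q, D q -> differentiable F q /\
    forall v : R[i] * state, {for q, continuous (fun q' => 'd F q' v)}.

Definition real_on I U F : Prop :=
  forall t y, I t -> U y ->
    exists v : 'rV[R]_d, F (t%:C%C, cplx y) = cplx v.

(* [phi t s y] is the value at time t + s of the solution of y' = F (t, y)
   that equals y at time t. Nearness of (s, (t, y)) to (0, (t0, y0)) is joint:
   the radius of the disc of steps s on which the solution exists is locally
   uniform in the initial data. *)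
Definition exact_flow J V F phi : Prop :=
  (forall t y, J t -> V y -> phi t 0 y = y) /\
  forall t0 y0, J t0 -> V y0 ->
    \forall x \near (0 : R[i], (t0, y0)),
      let: (s, (t, y)) := x in
      [/\ J (t + s), V (phi t s y) &
          is_derive s 1 (fun u => phi t u y) (F (t + s, phi t s y))].

(* [Phi t s y] is the result of one step of size s from the state y at time t.
   The remainder of the local error expansion is O(s^(p+3)) locally uniformly
   in (t, y), as needed when the expansion is used from a state that itself
   depends on the step. *)
Definition method_order (p : nat) J V phi Phi (c1 c2 : R) F1 F2 : Prop :=
  forall t0 y0, J t0 -> V y0 ->
    (fun x : R[i] * (R[i] * state) =>
       let: (s, (t, y)) := x in
       Phi t s y - (phi t s y
         + (c1%:C%C * s ^+ p.+1) *: F1 (t, y)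
         + (c2%:C%C * s ^+ p.+2) *: F2 (t, y)))
    =O_ (nbhs (0 : R[i], (t0, y0))) (fun x => x.1 ^+ p.+3).

(* Derivative of G along the solutions of y' = F (t, y). *)
Definition flow_deriv F (G : R[i] * state -> state) (q : R[i] * state) : state :=
  'd G q (1, F q).

(* Jacobian of F with respect to y, applied to G. *)
Definition state_deriv F (G : R[i] * state -> state) (q : R[i] * state) : state :=
  'd F q (0, G q).

(* If g1 + g2 = 1 and g1^(p+1) + g2^(p+1) = 0, then g1 = 1/2 + s i,
   g2 = 1/2 - s i and g1^(p+1) = b i, with s and b real and nonzero, and
     Phi_(g2 tau) (Phi_(g1 tau) y) - phi_tau y
       = tau^(p+2) (s b A - (b / 2) i B) + O(tau^(p+3)),
     A = c1 (flow_deriv F F1 + state_deriv F F1) - 2 c2 F2,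
     B = c1 (flow_deriv F F1 - state_deriv F F1).
   The next two predicates say that A and B do not vanish at q. For Euler's
   method and y' = y one has B = 0, the composition is real, and the error of
   its real part is not zero; in general, if exactly one of A and B vanishes,
   the two norms have different orders, or one of them is eventually 0. *)
Definition re_nondegenerate F (c1 c2 : R) F1 F2 q : Prop :=
  c1%:C%C *: (flow_deriv F F1 q + state_deriv F F1 q)
    - (2 * c2)%:C%C *: F2 q != 0.

Definition im_nondegenerate F (c1 : R) F1 q : Prop :=
  c1%:C%C *: (flow_deriv F F1 q - state_deriv F F1 q) != 0.

End Ode.

(* Main.v *)
Require Import Defs.
From mathcomp Require Import all_boot all_order all_algebra.
From mathcomp Require Import all_classical all_reals all_analysis.
From mathcomp Require Import complex.
From mathcomp Require Import ring lra.

Set Implicit Arguments.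
Unset Strict Implicit.
Unset Printing Implicit Defensive.

Import Order.TTheory GRing.Theory Num.Theory.
Import numFieldNormedType.Exports.

Local Open Scope classical_set_scope.
Local Open Scope ring_scope.

(** The composition is expanded in the real step tau. Write delta for the error of
    the first step. The second step starts from a perturbed state, and the flow
    carries this perturbation to delta + gamma2 tau D_y f delta, up to
    o(tau) |delta| ([flow_variation]). Adding the local error of the second step,
    with its leading coefficient expanded at the initial data, one finds
    ([composition_expansion])
      Psi tau - phi tau = tau^(p+1) c1 (gamma1^(p+1) + gamma2^(p+1)) F1
                          + tau^(p+2) E + o(tau^(p+2)).
    The condition on gamma1 and gamma2 cancels the first term. Together with
    gamma1 + gamma2 = 1 it also makes gamma1 = 1/2 + s i and gamma2 = 1/2 - s i
    conjugate, with gamma1^(p+1) = b i, b real ([conjugate_coefficients]); then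
    E = s b A - (b / 2) i B, where A and B are the vectors that the nondegeneracy
    hypotheses assume to be nonzero.

    The vectors A and B are real, because F1, F2 and f are real at real arguments
    and so are their derivatives in real directions ([real_diff]). The exact
    solution is real for real tau ([flow_real]). Hence phi - Re Psi is
    -tau^(p+2) s b A and Im Psi is -tau^(p+2) (b / 2) B, both up to
    o(tau^(p+2)), and the two Euclidean norms are equivalent with the constant
    C = |s b| ||A|| / (|b / 2| ||B||).

    The flow is known only through its differential equation in complex time. Every
    property of it that is used (dependence on the initial state, uniqueness,
    reality) follows from a comparison principle for curves of a real variable
    ([comparison]), applied along a segment of complex times. The vector field
    enters through its strict differentiability ([holomorphic_strict]). *)

(** * A real-valued norm on complex normed modules *)

Section RealNorm.
Context {R : realType}.
Implicit Types (E : normedModType R[i]) (c : R[i]).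

(** The norm of a normed module over [R[i]] takes its values in [R[i]], which is
    only partially ordered; [nr] is the same norm with values in [R]. *)
Definition nr {E : normedModType R[i]} (z : E) : R := complex.Re `|z|.

Lemma nrE E (z : E) : (nr z)%:C%C = `|z|.
Proof. by rewrite /nr RRe_real // ger0_real. Qed.

Lemma nr_ge0 E (z : E) : 0 <= nr z.
Proof. by rewrite -lecR nrE normr_ge0. Qed.

Lemma nr0 E : nr (0 : E) = 0.
Proof. by rewrite /nr normr0. Qed.

Lemma nr0_eq0 E (z : E) : nr z = 0 -> z = 0.
Proof. by move=> z0; apply/normr0_eq0; rewrite -nrE z0. Qed.

Lemma nrN E (z : E) : nr (- z) = nr z.
Proof. by rewrite /nr normrN. Qed.

Lemma nrD E (y z : E) : nr (y + z) <= nr y + nr z.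
Proof. by rewrite -lecR rmorphD /= !nrE ler_normD. Qed.

Lemma nrB E (y z : E) : nr (y - z) <= nr y + nr z.
Proof. by rewrite -(nrN z) nrD. Qed.

Lemma nr_distC E (y z : E) : nr (y - z) = nr (z - y).
Proof. by rewrite /nr distrC. Qed.

Lemma nr_sum E n (F : 'I_n -> E) : nr (\sum_(k < n) F k) <= \sum_(k < n) nr (F k).
Proof.
elim/big_rec2: _ => [|k x z _ H]; first by rewrite nr0.
by rewrite (le_trans (nrD _ _))// lerD2l.
Qed.

Lemma nrZ E c (z : E) : nr (c *: z) = nr c * nr z.
Proof. by apply: complexI; rewrite rmorphM /= !nrE normrZ. Qed.

Lemma nrM c c' : nr (c * c') = nr c * nr c'.
Proof. by apply: complexI; rewrite rmorphM /= !nrE normrM. Qed.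

Lemma nrX c n : nr (c ^+ n) = nr c ^+ n.
Proof. by apply: complexI; rewrite rmorphXn /= !nrE normrX. Qed.

Lemma nrR (x : R) : nr x%:C%C = `|x|.
Proof. by rewrite /nr normc_def /= expr0n addr0 sqrtr_sqr. Qed.

Lemma nr_i : nr ('i%C : R[i]) = 1.
Proof. by rewrite /nr normc_def /= expr0n expr1n add0r sqrtr1. Qed.

Lemma nr_Re c : `|complex.Re c| <= nr c.
Proof. by rewrite -lecR nrE normc_ge_Re. Qed.

Lemma nr_Im c : `|complex.Im c| <= nr c.
Proof.
have -> : nr c = nr (- ('i%C * c)) by rewrite nrN nrM nr_i mul1r.
by apply: le_trans (nr_Re _); case: c => a b /=; rewrite mul0r mul1r sub0r opprK.
Qed.

Lemma nr_le_ReIm c : nr c <= `|complex.Re c| + `|complex.Im c|.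
Proof.
by rewrite [c in nr c]complexE (le_trans (nrD _ _)) // nrM !nrR nr_i mul1r.
Qed.

Lemma nr_pair (E E' : normedModType R[i]) (z : E * E') :
  nr z = Num.max (nr z.1) (nr z.2).
Proof.
apply: complexI; rewrite nrE.
have -> : `|z| = Num.max `|z.1| `|z.2| by [].
by rewrite -!nrE /Order.max ltcR; case: ifP.
Qed.

Lemma nr_fst (E E' : normedModType R[i]) (z : E * E') : nr z.1 <= nr z.
Proof. by rewrite nr_pair le_max lexx. Qed.

Lemma nr_snd (E E' : normedModType R[i]) (z : E * E') : nr z.2 <= nr z.
Proof. by rewrite nr_pair le_max lexx orbT. Qed.

Lemma nr_coord n (z : 'rV[R[i]]_n) k : nr (z ord0 k) <= nr z.
Proof.
rewrite -lecR !nrE.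
have -> : `|z| = mx_norm z by [].
have : (`|z ord0 k|%:nng <= \big[Num.max/0%:nng]_i `|z i.1 i.2|%:nng)%R.
  by apply/bigmax_geP; right; exists (ord0, k).
by rewrite mx_normE -num_le.
Qed.

Lemma nr_row_le n (z : 'rV[R[i]]_n) (a : R) :
  0 <= a -> (forall k, nr (z ord0 k) <= a) -> nr z <= a.
Proof.
move=> a0 za; rewrite -lecR nrE.
have -> : `|z| = mx_norm z by [].
have [->|/mx_norm_neq0[[i j] ->]] := eqVneq (mx_norm z) 0; first by rewrite ler0c.
by rewrite /= -nrE lecR ord1.
Qed.

Lemma nbhs_nr E (x : E) (P : set E) :
  nbhs x P <-> exists2 e : R, 0 < e & forall y, nr (y - x) < e -> P y.
Proof.
split=> [/nbhs_normP[e /= e0 eP]|[e e0 eP]].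
  have eR : (complex.Re e)%:C%C = e by rewrite RRe_real // gtr0_real.
  exists (complex.Re e); first by rewrite -ltcR eR.
  move=> y ye; apply: eP; rewrite /= distrC -eR -nrE ltcR //.
apply/nbhs_normP; exists e%:C%C; first by rewrite /= ltcR.
by move=> y /=; rewrite distrC -nrE ltcR; exact: eP.
Qed.

Lemma differentiable_nr (E E' : normedModType R[i]) (F : E -> E') q (e : R) :
  differentiable F q -> 0 < e ->
  exists2 r : R, 0 < r & forall h, nr h < r ->
    nr (F (q + h) - F q - 'd F q h) <= e * nr h.
Proof.
move=> dF e0.
have /diff_locally/eqaddoP := dF.
move=> /(_ e%:C%C); rewrite ltcR => /(_ e0) /nbhs_nr[r r0 rP].
exists r => // h hr; rewrite -lecR rmorphM /= !nrE.
by have := rP h; rewrite subr0 => /(_ hr); rewrite /= !fctE /= [h + q]addrC opprD addrA.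
Qed.

Lemma is_derive_nr E (f : R[i] -> E) (s : R[i]) v (e : R) :
  is_derive s 1 f v -> 0 < e ->
  exists2 r : R, 0 < r & forall h, nr h < r ->
    nr (f (s + h) - f s - h *: v) <= e * nr h.
Proof.
move=> [df dfv] e0.
have : h^-1 *: ((f \o shift s) (h *: 1) - f s) @[h --> 0^'] --> v.
  by rewrite -dfv; exact: df.
move=> /cvgrPdist_le /(_ e%:C%C); rewrite ltcR => /(_ e0).
rewrite /prop_near1 /dnbhs /within /= => /nbhs_nr[r r0 rP].
exists r => // h hr.
have [->|h0] := eqVneq h 0.
  by rewrite addr0 subrr scale0r subr0 !nr0 mulr0.
have := rP h; rewrite subr0 => /(_ hr h0).
rewrite /= [h%:A]mulr1 [h + s]addrC -nrE lecR => H.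
have -> : f (s + h) - f s - h *: v = - (h *: (v - h^-1 *: (f (s + h) - f s))).
  by rewrite scalerBr scalerA divff // scale1r opprB.
by rewrite nrN nrZ mulrC ler_wpM2r // nr_ge0.
Qed.

Lemma bigO_nr (E E' E'' : normedModType R[i]) (f : E -> E') (g : E -> E'') x :
  f =O_ (nbhs x) g -> exists2 K : R, 0 < K & exists2 r : R, 0 < r &
    forall y, nr (y - x) < r -> nr (f y) <= K * nr (g y).
Proof.
move=> /eqO_exP[k k0 /nbhs_nr[r r0 rP]].
have kR : (complex.Re k)%:C%C = k by rewrite RRe_real // gtr0_real.
exists (complex.Re k); first by rewrite -ltcR kR.
exists r => // y yr; rewrite -lecR rmorphM /= kR !nrE; exact: rP.
Qed.

End RealNorm.

(** * Curves of a real variable: a mean value inequality and a comparison principle *)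

Section Curves.
Context {R : realType}.
Implicit Types (E : normedModType R[i]) (s t : R).

(** The curve [D] has the derivative [v] at [s], with respect to the real
    variable. The space [E] is a module over [R[i]] only, so that the derivative
    is spelt out rather than taken from the theory of differentiation. *)
Definition rder {E : normedModType R[i]} (D : R -> E) (s : R) (v : E) : Prop :=
  forall e : R, 0 < e -> exists2 r : R, 0 < r & forall h : R, `|h| < r ->
    nr (D (s + h) - D s - h%:C%C *: v) <= e * `|h|.

Lemma subr_subACA (V : zmodType) (x y z t : V) :
  x - y - (z - t) = x - z - (y - t).
Proof. by rewrite !opprB !addrA addrAC [RHS]addrAC (addrAC x). Qed.

Lemma rderB E (D1 D2 : R -> E) s v1 v2 :
  rder D1 s v1 -> rder D2 s v2 -> rder (fun t => D1 t - D2 t) s (v1 - v2).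
Proof.
move=> d1 d2 e e0; have e20 : 0 < e / 2 by rewrite divr_gt0.
have [r1 r10 H1] := d1 _ e20; have [r2 r20 H2] := d2 _ e20.
exists (Num.min r1 r2); first by rewrite lt_min r10.
move=> h; rewrite lt_min => /andP[/H1 {}H1 /H2 {}H2].
have -> : D1 (s + h) - D2 (s + h) - (D1 s - D2 s) - h%:C%C *: (v1 - v2) =
  (D1 (s + h) - D1 s - h%:C%C *: v1) - (D2 (s + h) - D2 s - h%:C%C *: v2).
  by rewrite scalerBr [RHS]subr_subACA; congr (_ - _); exact: subr_subACA.
by rewrite (le_trans (nrB _ _))//; lra.
Qed.

Lemma rder_line E (w : E) s : rder (fun t => t%:C%C *: w) s w.
Proof.
move=> e e0; exists 1 => // h _.
rewrite rmorphD /= scalerDl [s%:C%C *: w + _]addrC addrK subrr nr0.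
by rewrite mulr_ge0 // ltW.
Qed.

Lemma rder_continuous E (D : R -> E) s v : rder D s v ->
  forall e, 0 < e -> exists2 r : R, 0 < r & forall t, `|t - s| < r ->
    nr (D t - D s) < e.
Proof.
move=> dD e e0; have [r r0 H] := dD 1 ltr01.
have K0 : 0 < 1 + nr v by rewrite ltr_wpDr // nr_ge0.
exists (Num.min r (e / (1 + nr v))); first by rewrite lt_min r0 divr_gt0.
move=> t; rewrite lt_min ltr_pdivlMr // => /andP[/H]; rewrite subrKC => H1 H2.
rewrite (le_lt_trans _ H2)//.
rewrite -[D t - D s](subrK ((t - s)%:C%C *: v)) (le_trans (nrD _ _))//.
by rewrite nrZ nrR; lra.
Qed.

Lemma rder_nr_continuous E (D : R -> E) s v :
  rder D s v -> {for s, continuous (fun t => nr (D t))}.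
Proof.
move=> dD; apply/cvgrPdist_lt => e e0.
have [r r0 H] := rder_continuous dD e0.
apply/nbhs_normP; exists r => //= t /=; rewrite distrC => tr; have ts := H t tr.
have := nrD (D t - D s) (D s); rewrite subrK.
have := nrD (D s - D t) (D t); rewrite subrK nr_distC.
by rewrite ltr_norml; lra.
Qed.

Lemma rder_is_derive E (l : E -> R) (D : R -> E) s v :
  additive l -> (forall (x : R) z, l (x%:C%C *: z) = x * l z) ->
  (forall z, `|l z| <= nr z) ->
  rder D s v -> is_derive s 1 (fun t => l (D t)) (l v).
Proof.
move=> ladd lscal lbnd dD.
suff H : h^-1 *: (((fun t => l (D t)) \o shift s) (h *: 1) - l (D s)) @[h --> 0^']
    --> l v.
  by split; [apply/cvg_ex; exists (l v)|exact/cvg_lim].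
apply/cvgrPdist_le => e e0; have [r r0 H] := dD e e0.
rewrite /prop_near1 /dnbhs /within /=; apply/nbhs_normP; exists r => //= h /=.
rewrite sub0r normrN => hr h0; have := H h hr.
rewrite /= [h%:A]mulr1 [h + s]addrC => H1.
have h0' : 0 < `|h| by rewrite normr_gt0.
rewrite -(ler_pM2r h0') -normrM (le_trans _ H1)// (le_trans _ (lbnd _))//.
rewrite !ladd lscal distrC /GRing.scale /= mulrBl [_^-1 * _]mulrC divfK //.
by rewrite [l v * _]mulrC.
Qed.

Lemma rder_functional_le E (l : E -> R) (D D' : R -> E) (a b K : R) :
  additive l -> (forall (x : R) z, l (x%:C%C *: z) = x * l z) ->
  (forall z, `|l z| <= nr z) -> a <= b ->
  (forall t, a <= t <= b -> rder D t (D' t)) ->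
  (forall t, a <= t <= b -> nr (D' t) <= K) ->
  `|l (D b - D a)| <= K * (b - a).
Proof.
move=> ladd lscal lbnd ab dD bD.
have der t : a <= t <= b -> is_derive t 1 (fun u => l (D u)) (l (D' t)).
  by move=> tab; apply: rder_is_derive => //; exact: dD.
have [||c] := @MVT_segment R (fun u => l (D u)) (fun t => l (D' t)) a b ab.
- by move=> x; rewrite in_itv /= => /andP[ax xb]; apply: der; rewrite !ltW.
- apply: continuous_in_subspaceT => x; rewrite inE /= in_itv /= => xab.
  apply: differentiable_continuous; apply/derivable1_diffP.
  by case: (der x xab).
rewrite in_itv /= => cab; rewrite -ladd => ->.
rewrite normrM [`|b - a|]ger0_norm ?subr_ge0 // ler_wpM2r ?subr_ge0 //.
by rewrite (le_trans (lbnd _))// bD.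
Qed.

(** The factor 2 accounts for the separate treatment of the real and imaginary
    parts of each coordinate. *)
Lemma mean_value_le n (D D' : R -> 'rV[R[i]]_n) (a b K : R) : a <= b ->
  (forall t, a <= t <= b -> rder D t (D' t)) ->
  (forall t, a <= t <= b -> nr (D' t) <= K) ->
  nr (D b - D a) <= 2 * K * (b - a).
Proof.
move=> ab dD bD.
have K0 : 0 <= K by rewrite (le_trans (nr_ge0 _) (bD a _)) // lexx.
apply: nr_row_le => [|k]; first by rewrite !mulr_ge0 // subr_ge0.
rewrite (le_trans (nr_le_ReIm _))//.
have -> : 2 * K * (b - a) = K * (b - a) + K * (b - a) by ring.
apply: lerD.
- apply: (@rder_functional_le _ (fun z : 'rV_n => complex.Re (z ord0 k)) D D') => //.
  + by move=> y z; rewrite !mxE; case: (y _ _) (z _ _) => ? ? [].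
  + by move=> x z; rewrite !mxE; case: (z _ _) => u w /=; rewrite mul0r subr0.
  + by move=> z; rewrite (le_trans (nr_Re _)) // nr_coord.
- apply: (@rder_functional_le _ (fun z : 'rV_n => complex.Im (z ord0 k)) D D') => //.
  + by move=> y z; rewrite !mxE; case: (y _ _) (z _ _) => ? ? [].
  + by move=> x z; rewrite !mxE; case: (z _ _) => u w /=; rewrite mul0r addr0.
  + by move=> z; rewrite (le_trans (nr_Im _)) // nr_coord.
Qed.

(** The maximum M of the norm of D on [0, b] satisfies M <= |D(0)| + 2 k M. *)
Lemma comparison_le n (D D' : R -> 'rV[R[i]]_n) (b k : R) : 0 <= b <= 1 ->
  0 <= k <= 1 / 4 ->
  (forall t, 0 <= t <= b -> rder D t (D' t)) ->
  (forall t, 0 <= t <= b -> nr (D' t) <= k * nr (D t)) ->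
  forall t, 0 <= t <= b -> nr (D t) <= 2 * nr (D 0).
Proof.
move=> /andP[b0 b1] /andP[k0 k4] dD bD.
have [c|c /[!in_itv] /= cb cmax] := @EVT_max R (fun t => nr (D t)) 0 b b0.
  apply: continuous_in_subspaceT => x; rewrite inE /= in_itv /= => xb.
  exact: rder_nr_continuous (dD x xb).
suff cD : nr (D c) <= 2 * nr (D 0).
  by move=> t tb; rewrite (le_trans _ cD) // cmax // in_itv.
have /andP[c0 cb'] := cb.
have H : nr (D c - D 0) <= 2 * (k * nr (D c)) * (c - 0).
  apply: (@mean_value_le _ D D') => // t /andP[t0 tc].
    by apply: dD; rewrite t0 (le_trans tc).
  have tb : 0 <= t <= b by rewrite t0 (le_trans tc).
  by rewrite (le_trans (bD t tb))// ler_wpM2l // cmax // in_itv.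
have := nrD (D c - D 0) (D 0); rewrite subrK => H2.
have H3 : 2 * (k * nr (D c)) * (c - 0) <= nr (D c) / 2.
  have Dc0 := nr_ge0 (D c).
  have : k * nr (D c) <= 1 / 4 * nr (D c) by rewrite ler_wpM2r.
  have : 2 * (k * nr (D c)) * (c - 0) <= 2 * (k * nr (D c)) * 1.
    by rewrite ler_wpM2l ?mulr_ge0 // subr0 (le_trans cb').
  lra.
lra.
Qed.

(** The differential inequality is only needed while the curve is in the ball of
    radius [r], because the conclusion keeps it there. *)
Lemma comparison n (D D' : R -> 'rV[R[i]]_n) (k r : R) :
  0 <= k <= 1 / 4 ->
  (forall t, 0 <= t <= 1 -> rder D t (D' t)) ->
  (forall t, 0 <= t <= 1 -> nr (D t) <= r -> nr (D' t) <= k * nr (D t)) ->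
  2 * nr (D 0) < r ->
  forall t, 0 <= t <= 1 -> nr (D t) <= 2 * nr (D 0).
Proof.
move=> k4 dD bD D0r.
have step b : 0 <= b <= 1 -> (forall t, 0 <= t <= b -> nr (D t) <= r) ->
    forall t, 0 <= t <= b -> nr (D t) <= 2 * nr (D 0).
  move=> b01 br; have t01 t : 0 <= t <= b -> 0 <= t <= 1.
    by case/andP: b01 => _ b1 /andP[-> tb]; exact: le_trans b1.
  apply: (@comparison_le n D D' b k) => // t tb; first exact/dD/t01.
  by apply: bD; [exact: t01|exact: br].
(* Otherwise let b be the first time at which the curve reaches the sphere of
   radius r: up to time b the inequality holds, so D b is in the open ball. *)
pose B := [set t | 0 <= t <= 1 /\ r <= nr (D t)].
have [[t1 Bt1]|B0] := pselect (exists t, B t); last first.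
  apply: step => [|t t01]; first by rewrite ler01 lexx.
  by rewrite leNgt; apply/negP => rt; apply: B0; exists t; split => //; exact: ltW.
have hB : has_inf B by split; [exists t1|exists 0 => x [/andP[]]].
set b := inf B.
have b0 : 0 <= b by apply: lb_le_inf; [exists t1|move=> x [/andP[]]].
have bt1 : b <= t1 by apply: ge_inf => //; case: hB.
have b01 : 0 <= b <= 1 by rewrite b0; case: Bt1 => /andP[_ t11] _; exact: le_trans t11.
have lt_r t : 0 <= t < b -> nr (D t) < r.
  move=> /andP[t0 tb]; rewrite ltNge; apply/negP => rt.
  suff : b <= t by rewrite leNgt tb.
  apply: ge_inf; first by case: hB.
  by split=> //; rewrite t0 (le_trans (ltW tb)) //; case/andP: b01.
have D00 := nr_ge0 (D 0).
have bb : 0 <= b <= b by rewrite b0 lexx.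
have Db : nr (D b) <= r.
  rewrite leNgt; apply/negP => rb.
  have b_gt0 : 0 < b.
    by rewrite lt_neqAle b0 andbT; apply/eqP => b00; move: rb; rewrite -b00; lra.
  have [d d0 H] := rder_continuous (dD b b01) (e := nr (D b) - r) ltac:(lra).
  pose t := Num.max 0 (b - d / 2).
  have tb : 0 <= t < b by rewrite /t le_max lexx /= gt_max b_gt0 /=; lra.
  have td : `|t - b| < d.
    rewrite ltr_norml; case/andP: tb => t0 tb.
    have : b - d / 2 <= t by rewrite /t le_max lexx orbT.
    by lra.
  have := H t td; have := lt_r t tb; rewrite nr_distC.
  have := nrD (D b - D t) (D t); rewrite subrK; lra.
have Dbr : nr (D b) <= 2 * nr (D 0).
  apply: step bb => // t /andP[t0]; rewrite le_eqVlt => /predU1P[->//|tb].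
  by apply/ltW/lt_r; rewrite t0.
have [d d0 H] := rder_continuous (dD b b01) (e := r - nr (D b)) ltac:(lra).
have [t [t01 rt] tbd] := inf_adherent d0 hB.
have bt : b <= t by apply: ge_inf => //; case: hB.
have : nr (D t - D b) < r - nr (D b).
  by apply: H; rewrite ger0_norm ?subr_ge0 // ltrBlDl.
have := nrD (D t - D b) (D b); rewrite subrK; lra.
Qed.

End Curves.

(** * Strict differentiability of holomorphic maps *)

Section Strict.
Context {R : realType}.

Lemma rder_comp_line (E E' : normedModType R[i]) (F : E -> E') a v (t : R) :
  differentiable F (a + t%:C%C *: v) ->
  rder (fun s : R => F (a + s%:C%C *: v)) t ('d F (a + t%:C%C *: v) v).
Proof.
move=> dF e e0; have K0 : 0 < 1 + nr v by rewrite ltr_wpDr // nr_ge0.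
have e10 : 0 < e / (1 + nr v) by rewrite divr_gt0.
have [r r0 H] := differentiable_nr dF e10.
exists (r / (1 + nr v)); first by rewrite divr_gt0.
move=> h; rewrite ltr_pdivlMr // => hr.
have hv : nr (h%:C%C *: v) <= `|h| * (1 + nr v).
  by rewrite nrZ nrR ler_wpM2l // lerDr.
have := H _ (le_lt_trans hv hr); rewrite linearZ /= -[a + _ + _]addrA -scalerDl -rmorphD /=.
move=> /le_trans; apply; rewrite -mulrA ler_wpM2l ?(ltW e0) //.
by rewrite mulrC ler_pdivrMr.
Qed.

Lemma rder_comp_derive (E : normedModType R[i]) (f : R[i] -> E) (a b : R[i]) v (t : R) :
  is_derive (a + t%:C%C * b) 1 f v ->
  rder (fun s : R => f (a + s%:C%C * b)) t (b *: v).
Proof.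
move=> df e e0; have K0 : 0 < 1 + nr b by rewrite ltr_wpDr // nr_ge0.
have e10 : 0 < e / (1 + nr b) by rewrite divr_gt0.
have [r r0 H] := is_derive_nr df e10.
exists (r / (1 + nr b)); first by rewrite divr_gt0.
move=> h; rewrite ltr_pdivlMr // => hr.
have hv : nr (h%:C%C * b) <= `|h| * (1 + nr b).
  by rewrite nrM nrR ler_wpM2l // lerDr.
have := H _ (le_lt_trans hv hr); rewrite -[a + _ + _]addrA -mulrDl -rmorphD /= -scalerA.
move=> /le_trans; apply; rewrite -mulrA ler_wpM2l ?(ltW e0) //.
by rewrite mulrC ler_pdivrMr.
Qed.

(** A linear map on R[i] * 'rV[R[i]]_n is bounded by its values on the basis. *)
Lemma linear_nr_le (E : normedModType R[i]) n (L : {linear (R[i] * 'rV[R[i]]_n)%type -> E}) z :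
  nr (L z) <= (nr (L (1, 0)) + \sum_(k < n) nr (L (0, delta_mx ord0 k))) * nr z.
Proof.
have zE : z = z.1 *: (1, 0) + \sum_(k < n) z.2 ord0 k *: (0, delta_mx ord0 k).
  rewrite [LHS]surjective_pairing [RHS]surjective_pairing /=; congr (_, _).
    rewrite [z.1 *: _]mulr1 (raddf_sum fst) /= big1 ?addr0 // => k _.
    by rewrite scaler0.
  by rewrite scaler0 add0r (raddf_sum snd) /= -row_sum_delta.
rewrite {1}zE linearD linearZ linear_sum /= (le_trans (nrD _ _))//.
rewrite mulrDl mulr_suml lerD ?nrZ //.
  by rewrite mulrC ler_wpM2l ?nr_ge0 ?nr_fst.
rewrite (le_trans (nr_sum _))// ler_sum // => k _.
rewrite linearZ nrZ mulrC ler_wpM2l ?nr_ge0 //.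
by rewrite (le_trans (nr_coord _ _))// nr_snd.
Qed.

Lemma differentiable_lipschitz (E : normedModType R[i]) n
    (G : R[i] * 'rV[R[i]]_n -> E) z : differentiable G z ->
  exists K : R, 0 <= K /\ exists2 r : R, 0 < r & forall h, nr h < r ->
    nr (G (z + h) - G z) <= K * nr h.
Proof.
move=> dG; have [r r0 H] := differentiable_nr dG ltr01.
exists (1 + (nr ('d G z (1, 0)) + \sum_(k < n) nr ('d G z (0, delta_mx ord0 k)))).
split; first by rewrite addr_ge0 // addr_ge0 ?nr_ge0 // sumr_ge0 // => k _; exact: nr_ge0.
exists r => // h hr; rewrite -[G (z + h) - G z](subrK ('d G z h)).
by rewrite (le_trans (nrD _ _))// mulrDl lerD ?H // linear_nr_le.
Qed.

(** The differential is continuous in operator norm, because it is continuous on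
    each basis vector; the mean value inequality on the segment from [q2] to [q1]
    then gives strict differentiability. *)
Lemma holomorphic_strict n (F : R[i] * 'rV[R[i]]_n -> 'rV[R[i]]_n) D
    (q : R[i] * 'rV[R[i]]_n) (e : R) :
  holomorphic_on D F -> nbhs q D -> 0 < e ->
  exists2 r : R, 0 < r & forall q1 q2 : R[i] * 'rV[R[i]]_n,
    nr (q1 - q) < r -> nr (q2 - q) < r ->
    nr (F q1 - F q2 - 'd F q (q1 - q2)) <= e * nr (q1 - q2).
Proof.
move=> holF Dq e0; pose eta := e / 2 / n.+1%:R.
have eta0 : 0 < eta by rewrite !divr_gt0.
have near_d v : \forall q' \near q, nr ('d F q' v - 'd F q v) < eta.
  have [_ /(_ v)] := holF q (nbhs_singleton Dq).
  move=> /cvgrPdist_lt /(_ eta%:C%C); rewrite ltcR => /(_ eta0).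
  by apply: filterS => q'; rewrite distrC -nrE ltcR.
have : \forall q' \near q, D q' /\ (nr ('d F q' (1, 0) - 'd F q (1, 0)) < eta /\
    forall k, nr ('d F q' (0, delta_mx ord0 k) - 'd F q (0, delta_mx ord0 k)) < eta).
  apply: (filterI Dq); apply: (filterI (near_d _)).
  apply: (@filter_forall _ 'I_n (fun k q' => nr ('d F q' (0, delta_mx ord0 k)
    - 'd F q (0, delta_mx ord0 k)) < eta) (nbhs q)) => k; exact: near_d.
move=> /nbhs_nr[r r0 rP]; exists r => // q1 q2 q1r q2r.
set w := q1 - q2.
have dw q' v : nr (q' - q) < r -> nr ('d F q' v - 'd F q v) <= e / 2 * nr v.
  move=> /rP[_ [H1 Hk]].
  rewrite (le_trans (linear_nr_le ('d F q' \- 'd F q) v))// ler_wpM2r ?nr_ge0 //.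
  have -> : e / 2 = eta + \sum_(k < n) eta.
    by rewrite sumr_const card_ord -mulrS -[RHS]mulr_natr /eta divfK.
  rewrite lerD ?(ltW H1) // ler_sum // => k _; exact/ltW/Hk.
have seg t : 0 <= t <= 1 -> nr (q2 + t%:C%C *: w - q) < r.
  move=> /andP[t0 t1].
  have -> : q2 + t%:C%C *: w - q = (1 - t)%:C%C *: (q2 - q) + t%:C%C *: (q1 - q).
    rewrite rmorphB /= scalerBl scale1r addrAC -[RHS]addrA; congr (_ + _).
    rewrite [RHS]addrC -scalerBr; congr (_ *: _).
    by rewrite opprB addrA subrK.
  rewrite (le_lt_trans (nrD _ _))// !nrZ !nrR !ger0_norm ?subr_ge0 //.
  have [->|tn0] := eqVneq t 0; first by rewrite mul0r addr0 subr0 mul1r.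
  have tp : 0 < t by rewrite lt_neqAle eq_sym tn0.
  have : t * nr (q1 - q) < t * r by rewrite ltr_pM2l.
  have : (1 - t) * nr (q2 - q) <= (1 - t) * r by rewrite ler_wpM2l ?subr_ge0 // ltW.
  lra.
have := @mean_value_le R n (fun t : R => F (q2 + t%:C%C *: w) - t%:C%C *: 'd F q w)
  (fun t : R => 'd F (q2 + t%:C%C *: w) w - 'd F q w) 0 1 (e / 2 * nr w) ler01.
rewrite !scale0r !scale1r subr0 addr0 /w [q2 + _]addrC subrK.
have -> : 2 * (e / 2 * nr (q1 - q2)) * (1 - 0) = e * nr (q1 - q2) by field.
rewrite [F q1 - _ - _]addrAC; apply => [t|t] t01.
- apply: rderB; last exact: rder_line.
  by apply: rder_comp_line; have [/holF[]] := rP _ (seg t t01).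
- by apply: dw; exact: seg.
Qed.

End Strict.

(** * Real vectors *)

Section Reality.
Context {R : realType}.

(** [inonreal z] is i times the imaginary part of [z]; it vanishes exactly when
    [z] is real. *)
Definition inonreal n (z : 'rV[R[i]]_n) : 'rV[R[i]]_n := z - cplx (reV z).

Lemma inonrealE n (z : 'rV[R[i]]_n) k :
  inonreal z ord0 k = 'i%C * (complex.Im (z ord0 k))%:C%C.
Proof.
rewrite !mxE; case: (z _ _) => a b; apply/eqP; rewrite eq_complex /=.
by apply/andP; split; apply/eqP; ring.
Qed.

Lemma inonrealD n (y z : 'rV[R[i]]_n) : inonreal (y + z) = inonreal y + inonreal z.
Proof.
apply/rowP => k; rewrite [RHS]mxE !inonrealE mxE -mulrDr -rmorphD /=.
by case: (y _ _) (z _ _) => ? ? [].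
Qed.

Lemma inonrealN n (z : 'rV[R[i]]_n) : inonreal (- z) = - inonreal z.
Proof.
apply/rowP => k; rewrite [RHS]mxE !inonrealE mxE -mulrN -rmorphN /=.
by case: (z _ _).
Qed.

Lemma inonrealB n (y z : 'rV[R[i]]_n) : inonreal (y - z) = inonreal y - inonreal z.
Proof. by rewrite inonrealD inonrealN. Qed.

Lemma inonrealZ n (x : R) (z : 'rV[R[i]]_n) :
  inonreal (x%:C%C *: z) = x%:C%C *: inonreal z.
Proof.
apply/rowP => k; rewrite [RHS]mxE !inonrealE mxE mulrCA -rmorphM /=.
by case: (z _ _) => ? ? /=; rewrite mul0r addr0.
Qed.

Lemma inonreal_cplx n (y : 'rV[R]_n) : inonreal (cplx y) = 0.
Proof. by apply/rowP => k; rewrite inonrealE !mxE /= mulr0. Qed.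

Lemma inonreal_imaginary n (y : R) (z : 'rV[R[i]]_n) : inonreal z = 0 ->
  inonreal ((y *i)%C *: z) = (y *i)%C *: z.
Proof.
move=> z0; apply/rowP => k; rewrite [RHS]mxE inonrealE mxE.
have := congr1 (fun u : 'rV_n => u ord0 k) z0; rewrite inonrealE [RHS]mxE.
case: (z ord0 k) => a b /= /eqP; rewrite eq_complex /= => /andP[_ /eqP Im0].
have -> : b = 0 by move: Im0; clear; lra.
by apply/eqP; rewrite eq_complex /=; apply/andP; split; apply/eqP; ring.
Qed.

Lemma nr_inonreal n (z : 'rV[R[i]]_n) : nr (inonreal z) <= nr z.
Proof.
apply: nr_row_le => [|k]; first exact: nr_ge0.
by rewrite inonrealE nrM nrR nr_i mul1r (le_trans (nr_Im _))// nr_coord.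
Qed.

Lemma rder_inonreal n (D : R -> 'rV[R[i]]_n) s v :
  rder D s v -> rder (fun t => inonreal (D t)) s (inonreal v).
Proof.
move=> dD e e0; have [r r0 H] := dD e e0; exists r => // h hr.
by rewrite -inonrealB -inonrealZ -inonrealB (le_trans (nr_inonreal _))// H.
Qed.

(** A real neighbourhood contains the real part of every point close to it. *)
Lemma nr_reV n (y : 'rV[R]_n) (U : set 'rV[R]_n) : nbhs y U ->
  exists2 r : R, 0 < r & forall z : 'rV[R[i]]_n, nr (z - cplx y) < r -> U (reV z).
Proof.
move=> /nbhs_ballP[r /= r0 rU]; exists r => // z zr; apply: rU.
split=> // i k; rewrite !ord1 !mxE /ball /= distrC.
apply: le_lt_trans zr; apply: le_trans (nr_coord _ k); apply: le_trans (nr_Re _).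
by rewrite !mxE; case: (z _ _) => a b /=.
Qed.

(** The derivative in a real direction is a limit of real difference quotients. *)
Lemma real_diff n (I : set R) (U : set 'rV[R]_n)
    (G : R[i] * 'rV[R[i]]_n -> 'rV[R[i]]_n) t y (a : R) w :
  open I -> open U -> I t -> U y -> real_on I U G ->
  differentiable G (t%:C%C, cplx y) ->
  inonreal ('d G (t%:C%C, cplx y) (a%:C%C, cplx w)) = 0.
Proof.
move=> oI oU It Uy realG dG; apply: nr0_eq0; apply/eqP; rewrite eq_le nr_ge0 andbT.
set q := (t%:C%C, cplx y); set v := (a%:C%C, cplx w).
have realP s u : I s -> U u -> inonreal (G (s%:C%C, cplx u)) = 0.
  by move=> /realG H /H[z ->]; exact: inonreal_cplx.
have linE (h : R) : q + h%:C%C *: v = ((t + h * a)%:C%C, cplx (y + h *: w)).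
  rewrite /q /v; congr (_, _); first by rewrite rmorphD rmorphM.
  by apply/rowP => k; rewrite !mxE rmorphD rmorphM.
have cI : \forall h \near (0 : R), I (t + h * a).
  have cv : t + h * a @[h --> (0 : R)] --> t + 0 * a.
    by apply: cvgD; [exact: cvg_cst|apply: cvgMr_tmp; exact: cvg_id].
  by apply: cv; rewrite mul0r addr0; exact: open_nbhs_nbhs.
have cU : \forall h \near (0 : R), U (y + h *: w).
  have cv : y + h *: w @[h --> (0 : R)] --> y + 0 *: w.
    by apply: cvgD; [exact: cvg_cst|apply: cvgZr_tmp; exact: cvg_id].
  by apply: cv; rewrite scale0r addr0; exact: open_nbhs_nbhs.
have /nbhs_normP[r0 /= r00 rP] : \forall h \near (0 : R), I (t + h * a) /\ U (y + h *: w).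
  by apply: filterI.
apply/ler_addgt0Pl => e e0; rewrite addr0.
have := @rder_comp_line R _ _ G q v 0; rewrite scale0r addr0 => /(_ dG e e0)[r r1 H].
pose h := Num.min r0 r / 2.
have m0 : 0 < Num.min r0 r by rewrite lt_min r00.
have h0 : 0 < h by rewrite divr_gt0.
have hm : h < Num.min r0 r by rewrite /h; lra.
have [Ih Uh] : I (t + h * a) /\ U (y + h *: w).
  by apply: rP; rewrite /= sub0r normrN gtr0_norm //; move: hm; rewrite lt_min => /andP[].
have := H h; rewrite gtr0_norm // add0r => /(_ _)/(le_trans (nr_inonreal _)).
move: hm; rewrite lt_min => /andP[_ ->] /(_ isT).
have q0 : q + (0 : R)%:C%C *: v = q by rewrite scale0r addr0.
rewrite !inonrealB q0 linE !realP // subr0 sub0r nrN inonrealZ nrZ nrR gtr0_norm //.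
by rewrite mulrC ler_pM2r.
Qed.

End Reality.

(** * Orders of magnitude in a real step *)

Section Orders.
Context {R : realType}.
Implicit Types (E : normedModType R[i]).

(** [small m X] and [bounded m X] mean that X(tau) is o(tau^m), respectively
    O(tau^m), as the real number tau tends to 0, the value at 0 included. *)
Definition small {E : normedModType R[i]} (m : nat) (X : R -> E) : Prop :=
  forall e : R, 0 < e -> \forall tau \near (0 : R), nr (X tau) <= e * `|tau| ^+ m.

Definition bounded {E : normedModType R[i]} (m : nat) (X : R -> E) : Prop :=
  exists2 K : R, 0 < K & \forall tau \near (0 : R), nr (X tau) <= K * `|tau| ^+ m.

Lemma near0_lt (r : R) : 0 < r -> \forall tau \near (0 : R), `|tau| < r.
Proof.
move=> r0; apply/nbhs_normP; exists r => //= tau /=.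
by rewrite sub0r normrN.
Qed.

Lemma near0_scale_lt (c : R[i]) (r : R) : 0 < r ->
  \forall tau \near (0 : R), nr (c * tau%:C%C) < r.
Proof.
move=> r0; have K0 : 0 < 1 + nr c by rewrite ltr_wpDr // nr_ge0.
apply: filterS (near0_lt (divr_gt0 r0 K0)) => tau.
rewrite ltr_pdivlMr // nrM nrR mulrC => /(le_lt_trans _); apply.
by rewrite ler_wpM2r // lerDr.
Qed.

Lemma smallD E m (X Y : R -> E) :
  small m X -> small m Y -> small m (fun tau => X tau + Y tau).
Proof.
move=> sX sY e e0; have e20 : 0 < e / 2 by rewrite divr_gt0.
apply: filterS2 (sX _ e20) (sY _ e20) => tau HX HY.
rewrite (le_trans (nrD _ _))//; lra.
Qed.

Lemma boundedD E m (X Y : R -> E) :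
  bounded m X -> bounded m Y -> bounded m (fun tau => X tau + Y tau).
Proof.
move=> [K K0 bX] [K' K'0 bY]; exists (K + K'); first by rewrite addr_gt0.
apply: filterS2 bX bY => tau HX HY.
rewrite (le_trans (nrD _ _))// mulrDl; lra.
Qed.

Lemma mul_div_succ_le (c e : R) : 0 <= c -> 0 < e -> c * (e / (1 + c)) <= e.
Proof.
move=> c0 e0; have K0 : 0 < 1 + c by rewrite ltr_wpDr.
by rewrite mulrA ler_pdivrMr // mulrC ler_wpM2l ?(ltW e0) // lerDr.
Qed.

Lemma small_scale E m k (c : R[i]) (X : R -> E) :
  small m X -> small (k + m) (fun tau => (c * tau%:C%C ^+ k) *: X tau).
Proof.
move=> sX e e0; have K0 : 0 < 1 + nr c by rewrite ltr_wpDr // nr_ge0.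
apply: filterS (sX _ (divr_gt0 e0 K0)) => tau H.
rewrite nrZ nrM nrX nrR exprD.
apply: le_trans (ler_wpM2l _ H) _; first by rewrite mulr_ge0 ?nr_ge0 ?exprn_ge0.
rewrite mulrACA ler_wpM2r ?mulr_ge0 ?exprn_ge0 //.
exact: mul_div_succ_le (nr_ge0 c) e0.
Qed.

Lemma bounded_scale E k (c : R[i]) (v : E) :
  bounded k (fun tau : R => (c * tau%:C%C ^+ k) *: v).
Proof.
exists (1 + nr c * nr v); first by rewrite ltr_wpDr ?mulr_ge0 ?nr_ge0.
apply: filterE => tau; rewrite nrZ nrM nrX nrR mulrAC.
by rewrite ler_wpM2r ?exprn_ge0 // lerDr.
Qed.

Lemma bounded_small E m k (X : R -> E) : (m < k)%N -> bounded k X -> small m X.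
Proof.
move=> mk [K K0 bX] e e0.
have h0 : 0 < Num.min 1 (e / K) by rewrite lt_min ltr01 divr_gt0.
apply: filterS2 (near0_lt h0) bX => tau.
rewrite lt_min => /andP[t1 tK] H; rewrite (le_trans H)//.
rewrite -(subnK mk) addnS -addSn addnC exprD mulrCA mulrC ler_wpM2r ?exprn_ge0 //.
rewrite exprS mulrA (@le_trans _ _ (K * `|tau|)) //.
  by rewrite ler_piMr ?mulr_ge0 ?(ltW K0) // exprn_ile1 // ltW.
by rewrite mulrC -ler_pdivlMr // ltW.
Qed.

Lemma bounded_le E m k (X : R -> E) : (m <= k)%N -> bounded k X -> bounded m X.
Proof.
rewrite leq_eqVlt => /predU1P[->//|mk] bX; exists 1 => //.
exact: (bounded_small mk bX) ltr01.
Qed.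

Lemma small_bound E E' m (c : R) (X : R -> E) (Y : R -> E') : 0 <= c ->
  (\forall tau \near (0 : R), nr (Y tau) <= c * nr (X tau)) ->
  small m X -> small m Y.
Proof.
move=> c0 cXY sX e e0; have K0 : 0 < 1 + c by rewrite ltr_wpDr.
apply: filterS2 cXY (sX _ (divr_gt0 e0 K0)) => tau H1 H2.
rewrite (le_trans H1)// (le_trans (ler_wpM2l c0 H2))//.
by rewrite mulrA ler_wpM2r ?exprn_ge0 // mul_div_succ_le.
Qed.

End Orders.

(** * Variation of the flow with the initial state *)

Section Flow.
Context {R : realType} {d : nat}.
Local Notation state := 'rV[R[i]]_d.
Variables (J : set R[i]) (V : set state) (F : R[i] * state -> state)
  (phi : R[i] -> R[i] -> state -> state).
Hypotheses (openJ : open J) (openV : open V) (holF : holomorphic_on (J `*` V) F)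
  (flow : exact_flow J V F phi).
Variables (t0 : R[i]) (y0 : state).
Hypotheses (Jt0 : J t0) (Vy0 : V y0).
Local Notation q := ((t0, y0) : R[i] * state).

Lemma nbhs_JV : nbhs q (J `*` V).
Proof. by exists (J, V) => //; split; exact: open_nbhs_nbhs. Qed.

Lemma near_step (P : R[i] * (R[i] * state) -> Prop) :
  (\forall x \near (0 : R[i], q), P x) -> exists2 r : R, 0 < r &
  forall (s t : R[i]) (y : state), nr s < r -> nr (t - t0) < r -> nr (y - y0) < r -> P (s, (t, y)).
Proof.
move=> /nbhs_nr[r r0 H]; exists r => // s t y sr tr yr; apply: H.
by rewrite !nr_pair /= !gt_max subr0 sr tr.
Qed.

Lemma flow_near : exists2 r : R, 0 < r &
  forall (s t : R[i]) (y : state), nr s < r -> nr (t - t0) < r -> nr (y - y0) < r ->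
    is_derive s 1 (fun u => phi t u y) (F (t + s, phi t s y)).
Proof.
have [_ /(_ _ _ Jt0 Vy0)/near_step[r r0 H]] := flow.
by exists r => // s t y sr tr yr; have [] := H s t y sr tr yr.
Qed.

Lemma flow_expansion (e : R) : 0 < e -> exists2 r : R, 0 < r &
  forall s : R[i], nr s < r -> nr (phi t0 s y0 - y0 - s *: F q) <= e * nr s.
Proof.
move=> e0; have [r r0 /(_ 0 t0 y0)] := flow_near.
rewrite !subrr !nr0 (flow.1 t0 y0) // addr0 => /(_ r0 r0 r0) dphi.
have [r' r'0 H] := is_derive_nr dphi e0; exists r' => // s sr.
by have := H s sr; rewrite add0r (flow.1 t0 y0).
Qed.

Lemma flow_close (e : R) : 0 < e -> exists2 r : R, 0 < r &
  forall s : R[i], nr s < r -> nr (phi t0 s y0 - y0) < e.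
Proof.
move=> e0; have [r r0 H] := flow_expansion ltr01.
have K0 : 0 < 1 + nr (F q) by rewrite ltr_wpDr // nr_ge0.
exists (Num.min r (e / (1 + nr (F q)))); first by rewrite lt_min r0 divr_gt0.
move=> s; rewrite lt_min ltr_pdivlMr // => /andP[/H H1 H2].
rewrite (le_lt_trans _ H2)//.
rewrite -[phi t0 s y0 - y0](subrK (s *: F q)) (le_trans (nrD _ _))//.
by rewrite nrZ; lra.
Qed.

(** The derivative of F in the state variable at q, and a bound for its norm. *)
Let L (u : state) : state := 'd F q (0, u).
Let Lam : R := nr ('d F q (1, 0)) + \sum_(k < d) nr ('d F q (0, delta_mx ord0 k)).

Let Lam_ge0 : 0 <= Lam.
Proof. by rewrite addr_ge0 ?nr_ge0 // sumr_ge0 // => k _; exact: nr_ge0. Qed.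

Let nr_L u : nr (L u) <= Lam * nr u.
Proof.
have -> : nr u = nr ((0, u) : R[i] * state).
  by rewrite nr_pair /= nr0 max_r // nr_ge0.
exact: linear_nr_le.
Qed.

Let L_B u v : L (u - v) = L u - L v.
Proof. by rewrite /L -raddfB; congr ('d F q (_, _)); rewrite subr0. Qed.

Lemma state_strict (e : R) : 0 < e -> exists2 r : R, 0 < r &
  forall (t : R[i]) (y z : state),
  nr (t - t0) < r -> nr (y - y0) < r -> nr (z - y0) < r ->
  nr (F (t, y) - F (t, z) - L (y - z)) <= e * nr (y - z).
Proof.
move=> e0; have [r r0 H] := holomorphic_strict holF nbhs_JV e0.
exists r => // t y z tr yr zr; have := H (t, y) (t, z).
have -> : (t, y) - (t, z) = (0, y - z) :> R[i] * state by congr (_, _); rewrite subrr.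
rewrite !nr_pair /= nr0 !gt_max tr yr zr max_r ?nr_ge0 //; exact.
Qed.

Lemma state_lipschitz : exists K : R, 0 <= K /\ exists2 r : R, 0 < r &
  forall (t : R[i]) (y z : state), nr (t - t0) < r -> nr (y - y0) < r -> nr (z - y0) < r ->
  nr (F (t, y) - F (t, z)) <= K * nr (y - z).
Proof.
exists (1 + Lam); split; first by rewrite addr_ge0.
have [r r0 H] := state_strict ltr01; exists r => // t y z tr yr zr.
rewrite -[F (t, y) - F (t, z)](subrK (L (y - z))) (le_trans (nrD _ _))//.
by rewrite mulrDl lerD // H.
Qed.

(** The difference D between the solution through y1 at time t0 + a and the
    solution through y0 at time t0 satisfies D' = L D + o(D) with D small, hence
    D(b) = D(0) + b L D(0) + o(b) |D(0)|. With D(0) = 0 this contains the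
    uniqueness of solutions. *)
Lemma flow_variation (e : R) : 0 < e -> exists2 r : R, 0 < r &
  forall (a b : R[i]) (y1 delta : state),
  nr a < r -> nr b < r -> nr (y1 - y0) < r -> delta = y1 - phi t0 a y0 ->
  nr (phi (t0 + a) b y1 - phi t0 (a + b) y0 - delta - b *: L delta)
    <= e * nr b * nr delta.
Proof.
move=> e0.
pose e1 := Num.min 1 (e / 8); have e10 : 0 < e1 by rewrite lt_min ltr01 divr_gt0.
have [e11 e1e] : e1 <= 1 /\ e1 <= e / 8 by split; rewrite ge_min lexx ?orbT.
have [rs' rs'0 strict'] := state_strict e10.
have /nbhs_nr[rJ rJ0 JVr] := nbhs_JV.
pose rs := Num.min rs' rJ; have rs0 : 0 < rs by rewrite lt_min rs'0.
have strict (t : R[i]) (y z : state) : nr (t - t0) < rs -> nr (y - y0) < rs -> nr (z - y0) < rs ->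
    nr (F (t, y) - F (t, z) - L (y - z)) <= e1 * nr (y - z).
  by rewrite !lt_min => /andP[? _] /andP[? _] /andP[? _]; exact: strict'.
have flow0 (t : R[i]) (y : state) : nr (t - t0) < rs -> nr (y - y0) < rs -> phi t 0 y = y.
  rewrite !lt_min => /andP[_ tr] /andP[_ yr].
  have [] : (J `*` V) (t, y) by apply: JVr; rewrite nr_pair /= gt_max tr.
  exact: (flow.1).
have [rf rf0 fnear] := flow_near.
have rs80 : 0 < rs / 8 by rewrite divr_gt0.
have [rc rc0 fclose] := flow_close rs80.
have L10 : 0 < 1 + Lam by rewrite ltr_wpDr.
pose rk := Num.min (1 / 4 / (1 + Lam)) (e / 16 / (1 + Lam) / (1 + Lam)).
have rk0 : 0 < rk by rewrite lt_min !divr_gt0.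
have [rkA rkB] : rk <= 1 / 4 / (1 + Lam) /\ rk <= e / 16 / (1 + Lam) / (1 + Lam).
  by split; rewrite ge_min lexx ?orbT.
clearbody rk.
pose r := Num.min (Num.min (rs / 8) (rf / 2)) (Num.min (rc / 2) rk).
have [rrs rrf rrc rrk] : [/\ r <= rs / 8, r <= rf / 2, r <= rc / 2 & r <= rk].
  by split; rewrite !ge_min lexx ?orbT.
exists r; first by rewrite !lt_min rk0 !divr_gt0.
move=> a b y1 delta ar br y1r deltaE.
pose u (s : R) := phi (t0 + a) (0 + s%:C%C * b) y1.
pose v (s : R) := phi t0 (a + s%:C%C * b) y0.
pose T (s : R) := t0 + a + s%:C%C * b.
pose D s := u s - v s.
pose D' s := b *: (F (T s, u s) - F (T s, v s)).
have sb (s : R) : 0 <= s <= 1 -> nr (s%:C%C * b) < r.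
  move=> /andP[s0 s1]; rewrite nrM nrR ger0_norm //.
  by rewrite (le_lt_trans _ br)// ler_piMl // nr_ge0.
have asb (s : R) : 0 <= s <= 1 -> nr (a + s%:C%C * b) < r + r.
  by move=> /sb H; rewrite (le_lt_trans (nrD _ _))// ltrD.
have TE (s : R) : T s = t0 + (a + s%:C%C * b) by rewrite /T addrA.
have T_r (s : R) : 0 <= s <= 1 -> nr (T s - t0) < rs.
  by move=> /asb; rewrite TE [t0 + _]addrC addrK; lra.
have v_r (s : R) : 0 <= s <= 1 -> nr (v s - y0) < rs / 8.
  by move=> /asb H; apply: fclose; lra.
have dD (s : R) : 0 <= s <= 1 -> rder D s (D' s).
  move=> s01; rewrite /D /D' scalerBr; apply: rderB.
  - apply: (@rder_comp_derive R _ (fun x => phi (t0 + a) x y1)).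
    rewrite /u /T add0r; apply: fnear; [have := sb s s01; lra|rewrite [t0 + a]addrC addrK; lra|lra].
  - apply: (@rder_comp_derive R _ (fun x => phi t0 x y0)).
    rewrite TE; apply: fnear; [have := asb s s01; lra|by rewrite subrr nr0|by rewrite subrr nr0].
have u_r (s : R) : 0 <= s <= 1 -> nr (D s) <= rs / 2 -> nr (u s - y0) < rs.
  move=> /v_r Hv HD; rewrite -(subrK (v s) (u s)) -addrA.
  by rewrite (le_lt_trans (nrD _ _))//; move: HD; rewrite /D; lra.
have stD (s : R) : 0 <= s <= 1 -> nr (D s) <= rs / 2 ->
    nr (F (T s, u s) - F (T s, v s) - L (D s)) <= e1 * nr (D s).
  move=> s01 HD; apply: strict; [exact: T_r|exact: u_r|].
  by have := v_r s s01; lra.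
have s0 : (0 : R) <= (0 : R) <= (1 : R) by rewrite lexx ler01.
have s1 : (0 : R) <= (1 : R) <= (1 : R) by rewrite lexx ler01.
have v0 : v 0 = phi t0 a y0 by rewrite /v mul0r addr0.
(* The comparison principle keeps D in the ball where [strict] applies, and
   gives |D| <= 2 |delta|. *)
have D0 : D 0 = delta.
  rewrite deltaE /D v0 /u mul0r addr0 flow0 //; last by lra.
  by rewrite [t0 + a]addrC addrK; lra.
have delta_r : nr delta < rs / 4.
  rewrite deltaE -(subrK y0 y1) -addrA (le_lt_trans (nrD _ _))//.
  have := v_r 0 s0; rewrite v0 nr_distC; lra.
set k := nr b * (1 + Lam).
have [k0 k4 ke] : [/\ 0 <= k, k <= 1 / 4 & k * (1 + Lam) <= e / 16].
  split; first by rewrite mulr_ge0 ?nr_ge0 // ltW.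
    by rewrite /k -ler_pdivlMr // (le_trans (ltW br))// (le_trans rrk).
  by rewrite /k -!ler_pdivlMr // (le_trans (ltW br))// (le_trans rrk).
have D'k (s : R) : 0 <= s <= 1 -> nr (D s) <= rs / 2 -> nr (D' s) <= k * nr (D s).
  move=> s01 HD; rewrite /D' nrZ /k -mulrA ler_wpM2l ?nr_ge0 //.
  rewrite -[F (T s, u s) - _](subrK (L (D s))) (le_trans (nrD _ _))// mulrDl lerD //.
  by rewrite (le_trans (stD s s01 HD))// ler_wpM2r // nr_ge0.
have D2 (s : R) : 0 <= s <= 1 -> nr (D s) <= 2 * nr delta.
  rewrite -D0; apply: (@comparison _ _ D D' k (rs / 2)) => //; first by rewrite k0.
  by rewrite D0; lra.
have Drs (s : R) : 0 <= s <= 1 -> nr (D s) <= rs / 2.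
  by move=> /D2; have := delta_r; lra.
have nd := nr_ge0 delta; have nb := nr_ge0 b.
have kd : 0 <= k * nr delta by rewrite mulr_ge0.
have Dd (s : R) : 0 <= s <= 1 -> nr (D s - delta) <= 4 * (k * nr delta).
  move=> /andP[s0' s1']; rewrite -D0.
  have := @mean_value_le R d D D' 0 s (k * (2 * nr delta)) s0'; rewrite D0.
  have s01 t : 0 <= t <= s -> 0 <= t <= 1 by move=> /andP[-> /le_trans]; exact.
  move=> /(_ (fun t ts => dD t (s01 t ts))) H.
  apply: le_trans (H _) _ => [t /s01 ts|].
    by rewrite (le_trans (D'k t ts (Drs t ts)))// ler_wpM2l // D2.
  have : 4 * (k * nr delta) * s <= 4 * (k * nr delta) * 1 by rewrite ler_wpM2l // mulr_ge0.
  by rewrite subr0; lra.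
(* The derivative of D(s) - s b L delta is b (o(|D|) + L (D(s) - delta)). *)
have := @mean_value_le R d (fun s => D s - s%:C%C *: (b *: L delta))
  (fun s => D' s - b *: L delta) 0 1 (nr b * (e / 2 * nr delta)) ler01.
rewrite scale0r scale1r subr0 D0.
have -> : D 1 - b *: L delta - delta =
    phi (t0 + a) b y1 - phi t0 (a + b) y0 - delta - b *: L delta.
  by rewrite addrAC /D /u /v add0r !mul1r.
have -> : 2 * (nr b * (e / 2 * nr delta)) * (1 - 0) = e * nr b * nr delta by field.
apply => s s01; first by apply: rderB; [exact: dD|exact: rder_line].
rewrite /D' -scalerBr nrZ ler_wpM2l //.
have -> : F (T s, u s) - F (T s, v s) - L delta =
    (F (T s, u s) - F (T s, v s) - L (D s)) + L (D s - delta).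
  by rewrite [L (D s - delta)]L_B addrA subrK.
rewrite (le_trans (nrD _ _))//.
have HL := le_trans (nr_L _) (ler_wpM2l Lam_ge0 (Dd s s01)).
have HS := le_trans (stD s s01 (Drs s s01)) (ler_wpM2l (ltW e10) (D2 s s01)).
have : e1 * nr delta <= e / 8 * nr delta by rewrite ler_wpM2r.
have : Lam * (k * nr delta) <= e / 16 * nr delta.
  rewrite mulrCA mulrA (le_trans _ (ler_wpM2r nd ke))// ler_wpM2r // ler_wpM2l //.
  by rewrite lerDr.
lra.
Qed.

End Flow.

Section Reality_of_the_flow.
Context {R : realType} {d : nat}.
Local Notation state := 'rV[R[i]]_d.
Variables (J : set R[i]) (V : set state) (F : R[i] * state -> state)
  (phi : R[i] -> R[i] -> state -> state).
Hypotheses (openJ : open J) (openV : open V) (holF : holomorphic_on (J `*` V) F)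
  (flow : exact_flow J V F phi).

(** The imaginary part w of a solution with real initial data satisfies
    |w'| <= K |w|, because F is real at the real part of the solution. *)
Lemma flow_real (I : set R) (U : set 'rV[R]_d) (t0 : R) (y0 : 'rV[R]_d) :
  open I -> open U -> I t0 -> U y0 -> J t0%:C%C -> V (cplx y0) -> real_on I U F ->
  \forall tau \near (0 : R), inonreal (phi t0%:C%C tau%:C%C (cplx y0)) = 0.
Proof.
move=> oI oU It0 Uy0 Jt0 Vy0 realF.
have [K [K0 [rl rl0 lip]]] := state_lipschitz openJ openV holF Jt0 Vy0.
have [rf rf0 fnear] := flow_near flow Jt0 Vy0.
have [rU rU0 HU] := nr_reV (open_nbhs_nbhs (conj oU Uy0)).
have /nbhs_normP[rI /= rI0 HI] := open_nbhs_nbhs (conj oI It0).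
pose rm := Num.min rU (rl / 2); have rm0 : 0 < rm by rewrite lt_min rU0 divr_gt0.
have [rc rc0 fclose] := flow_close flow Jt0 Vy0 rm0.
have K10 : 0 < 1 + K by rewrite ltr_wpDr.
have k0 : 0 < 1 / 4 / (1 + K) by rewrite !divr_gt0.
have r0 : 0 < Num.min (Num.min rl rf) (Num.min rI rc) by rewrite !lt_min rl0 rf0 rI0.
apply: filterS2 (near0_lt r0) (near0_lt k0) => tau.
rewrite !lt_min => /andP[/andP[taul tauf] /andP[tauI tauc]] tauk.
have lt_tau (s r : R) : 0 <= s <= 1 -> `|tau| < r -> `|s * tau| < r.
  move=> /andP[s0 s1]; apply: le_lt_trans.
  by rewrite normrM ger0_norm // ler_piMl.
pose T (s : R) := (t0 + s * tau)%:C%C.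
have TE s : t0%:C%C + s%:C%C * tau%:C%C = T s by rewrite /T rmorphD rmorphM.
have T0 s : T s - t0%:C%C = (s * tau)%:C%C by rewrite /T rmorphD addrC addKr.
pose w (s : R) := phi t0%:C%C (0 + s%:C%C * tau%:C%C) (cplx y0).
have wr s : 0 <= s <= 1 -> nr (w s - cplx y0) < rm.
  by move=> s01; apply: fclose; rewrite add0r -rmorphM nrR lt_tau.
have realFw s : 0 <= s <= 1 -> inonreal (F (T s, cplx (reV (w s)))) = 0.
  move=> s01; have [||v ->] := realF (t0 + s * tau) (reV (w s)).
  - by apply: HI; rewrite /= opprD addrA subrr sub0r normrN lt_tau.
  - by apply: HU; have := wr s s01; rewrite lt_min => /andP[].
  - exact: inonreal_cplx.
pose D s := inonreal (w s).
pose D' (s : R) := inonreal (tau%:C%C *: F (T s, w s)).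
have dD s : 0 <= s <= 1 -> rder D s (D' s).
  move=> s01; apply: rder_inonreal.
  apply: (@rder_comp_derive R _ (fun x => phi t0%:C%C x (cplx y0))).
  rewrite /w -TE add0r; apply: fnear; rewrite ?subrr ?nr0 //.
  by rewrite -rmorphM nrR lt_tau.
have wreal s : w s - cplx (reV (w s)) = D s by [].
have bD s : 0 <= s <= 1 -> nr (D s) <= 1 -> nr (D' s) <= `|tau| * K * nr (D s).
  move=> s01 _; rewrite /D' inonrealZ nrZ nrR -mulrA ler_wpM2l //.
  rewrite -[inonreal (F _)]subr0 -(realFw s s01) -inonrealB.
  rewrite (le_trans (nr_inonreal _))// -wreal lip //.
  - by rewrite T0 nrR lt_tau.
  - by have := wr s s01; rewrite lt_min => /andP[_]; lra.
  have -> : cplx (reV (w s)) - cplx y0 = (w s - cplx y0) - inonreal (w s - cplx y0).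
    rewrite inonrealB inonreal_cplx subr0 /inonreal opprB [RHS]addrC addrA.
    by rewrite subrK.
  rewrite (le_lt_trans (nrB _ _))//.
  have := nr_inonreal (w s - cplx y0).
  by have := wr s s01; rewrite lt_min => /andP[_]; lra.
have D0 : D 0 = 0 by rewrite /D /w mul0r addr0 (flow.1) // inonreal_cplx.
have kle : 0 <= `|tau| * K <= 1 / 4.
  rewrite mulr_ge0 //=; move: tauk; rewrite ltr_pdivlMr //.
  by have := normr_ge0 tau; lra.
have := @comparison R d D D' (`|tau| * K) 1 kle dD bD.
rewrite D0 nr0 mulr0 => /(_ ltr01 1); rewrite ler01 lexx => /(_ isT).
rewrite /D /w add0r mul1r => H; apply: nr0_eq0; apply/eqP.
by rewrite eq_le H nr_ge0.
Qed.

End Reality_of_the_flow.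

(** * Local error of the composition of two steps *)

Section Composition.
Context {R : realType} {d : nat}.
Local Notation state := 'rV[R[i]]_d.
Variables (J : set R[i]) (V : set state) (F F1 F2 : R[i] * state -> state)
  (phi Phi : R[i] -> R[i] -> state -> state) (p : nat) (c1 c2 : R).
Hypotheses (openJ : open J) (openV : open V) (holF : holomorphic_on (J `*` V) F)
  (holF1 : holomorphic_on (J `*` V) F1) (holF2 : holomorphic_on (J `*` V) F2)
  (flow : exact_flow J V F phi) (order : method_order p J V phi Phi c1 c2 F1 F2).
Variables (t0 : R[i]) (y0 : state).
Hypotheses (Jt0 : J t0) (Vy0 : V y0).
Local Notation q := ((t0, y0) : R[i] * state).

Lemma step_error : exists2 K : R, 0 < K & exists2 r : R, 0 < r &
  forall (s t : R[i]) (y : state),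
    nr s < r -> nr (t - t0) < r -> nr (y - y0) < r ->
    nr (Phi t s y - (phi t s y + (c1%:C%C * s ^+ p.+1) *: F1 (t, y)
                               + (c2%:C%C * s ^+ p.+2) *: F2 (t, y)))
      <= K * nr s ^+ p.+3.
Proof.
have [K K0 [r r0 H]] := bigO_nr (order Jt0 Vy0).
exists K => //; exists r => // s t y sr tr yr.
have := H (s, (t, y)); rewrite !nr_pair /= !gt_max subr0 sr tr yr => /(_ isT).
by rewrite nrX.
Qed.

(** Composition of the local errors of the two steps. The error of the first one
    is carried by the flow over the second step ([flow_variation]), and the
    coefficient F1 of the second one is expanded at the initial data. *)
Lemma composition_expansion (g1 g2 : R[i]) : (0 < p)%N ->
  small p.+2 (fun tau : R =>
    Phi (t0 + g1 * tau%:C%C) (g2 * tau%:C%C) (Phi t0 (g1 * tau%:C%C) y0)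
    - (phi t0 (g1 * tau%:C%C + g2 * tau%:C%C) y0
       + (tau%:C%C ^+ p.+1 * (c1%:C%C * (g1 ^+ p.+1 + g2 ^+ p.+1))) *: F1 q
       + tau%:C%C ^+ p.+2 *:
          ((c1%:C%C * g1 ^+ p.+1 * g2) *: state_deriv F F1 q
           + (c1%:C%C * g2 ^+ p.+1 * g1) *: flow_deriv F F1 q
           + (c2%:C%C * (g1 ^+ p.+2 + g2 ^+ p.+2)) *: F2 q))).
Proof.
move=> p0; pose L1 := state_deriv F F1 q; pose d1 := flow_deriv F F1 q.
rewrite -/L1 -/d1.
have JVq : (J `*` V) q by [].
have [dF1 _] := holF1 JVq; have [dF2 _] := holF2 JVq.
pose s1 (tau : R) : R[i] := g1 * tau%:C%C; pose s2 (tau : R) : R[i] := g2 * tau%:C%C.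
pose y1 (tau : R) : state := Phi t0 (s1 tau) y0.
pose ph1 (tau : R) : state := phi t0 (s1 tau) y0.
pose delta (tau : R) : state := y1 tau - ph1 tau.
have s1E tau k : s1 tau ^+ k = g1 ^+ k * tau%:C%C ^+ k by rewrite exprMn.
have s2E tau k : s2 tau ^+ k = g2 ^+ k * tau%:C%C ^+ k by rewrite exprMn.
have nr_s1 tau : nr (s1 tau) = nr g1 * `|tau| by rewrite nrM nrR.
have nr_s2 tau : nr (s2 tau) = nr g2 * `|tau| by rewrite nrM nrR.
have [K K0 [re re0 step]] := step_error.
(* R1 and R3 are the remainders of the local errors of the two steps. *)
pose R1 (tau : R) : state := delta tau - ((c1%:C%C * s1 tau ^+ p.+1) *: F1 q
  + (c2%:C%C * s1 tau ^+ p.+2) *: F2 q).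
have R1b : bounded p.+3 R1.
  exists (1 + K * nr g1 ^+ p.+3); first by rewrite ltr_wpDr // mulr_ge0 ?exprn_ge0 ?nr_ge0 // ltW.
  apply: filterS (near0_scale_lt g1 re0) => tau s1r.
  have := step (s1 tau) t0 y0 s1r; rewrite !subrr !nr0 => /(_ re0 re0).
  rewrite -addrA opprD addrA => /le_trans; apply.
  rewrite nr_s1 exprMn mulrA ler_wpM2r ?exprn_ge0 //.
  by rewrite lerDr.
have deltaE tau : delta tau = (c1%:C%C * g1 ^+ p.+1 * tau%:C%C ^+ p.+1) *: F1 q
    + ((c2%:C%C * g1 ^+ p.+2 * tau%:C%C ^+ p.+2) *: F2 q + R1 tau).
  have mul_s1 (c : R[i]) k : c * g1 ^+ k * tau%:C%C ^+ k = c * s1 tau ^+ k.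
    by rewrite s1E; exact/esym/mulrA.
  by rewrite !mul_s1 /R1 addrA [RHS]addrC subrK.
have delta2b : bounded p.+2 (fun tau =>
    (c2%:C%C * g1 ^+ p.+2 * tau%:C%C ^+ p.+2) *: F2 q + R1 tau).
  by apply: boundedD; [exact: bounded_scale|exact: bounded_le R1b].
have deltab : bounded p.+1 delta.
  rewrite (_ : delta = fun tau => (c1%:C%C * g1 ^+ p.+1 * tau%:C%C ^+ p.+1) *: F1 q
    + ((c2%:C%C * g1 ^+ p.+2 * tau%:C%C ^+ p.+2) *: F2 q + R1 tau)).
    by apply: boundedD; [exact: bounded_scale|exact: bounded_le delta2b].
  by apply/funext => tau; exact: deltaE.
pose Z (tau : R) : state := ph1 tau - y0 - s1 tau *: F q.
have Zs : small 1 Z.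
  move=> e e0; have e'0 : 0 < e / (1 + nr g1) by rewrite divr_gt0 // ltr_wpDr ?nr_ge0.
  have [r r0 H] := flow_expansion flow Jt0 Vy0 e'0.
  apply: filterS (near0_scale_lt g1 r0) => tau /H /le_trans; apply.
  rewrite nr_s1 expr1 mulrA ler_wpM2r // mulrC.
  exact: mul_div_succ_le (nr_ge0 g1) e0.
pose W (tau : R) : state := y1 tau - y0 - s1 tau *: F q.
have Ws : small 1 W.
  rewrite (_ : W = fun tau => delta tau + Z tau).
    by apply: smallD => //; apply: bounded_small deltab.
  by apply/funext => tau; rewrite /W /delta /Z !addrA subrK.
pose Y (tau : R) : state := y1 tau - y0.
have Yb : bounded 1 Y.
  rewrite (_ : Y = fun tau => (g1 * tau%:C%C ^+ 1) *: F q + W tau).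
    apply: boundedD; first exact: bounded_scale.
    by exists 1 => //; exact: Ws.
  by apply/funext => tau; rewrite expr1 /W addrC subrK.
have Yr (r : R) : 0 < r -> \forall tau \near (0 : R), nr (Y tau) < r.
  have Ys : small 0 Y by apply: bounded_small Yb.
  move=> r0; have r20 : 0 < r / 2 by rewrite divr_gt0.
  by apply: filterS (Ys _ r20) => tau; rewrite expr0; lra.
pose h (tau : R) : R[i] * state := (s1 tau, Y tau).
have hb : bounded 1 h.
  have [KY KY0 HY] := Yb; exists (nr g1 + KY); first by rewrite ltr_wpDl ?nr_ge0.
  apply: filterS HY => tau; rewrite expr1 => HY.
  rewrite nr_pair /= ge_max nr_s1 mulrDl lerDl (le_trans HY) ?lerDr ?mulr_ge0 ?nr_ge0 //.
  by rewrite ltW.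
have qh tau : q + h tau = (t0 + s1 tau, y1 tau) by congr (_, _); rewrite addrC subrK.
have hr (r : R) : 0 < r -> \forall tau \near (0 : R), nr (h tau) < r.
  move=> r0; apply: filterS2 (near0_scale_lt g1 r0) (Yr r r0) => tau H1 H2.
  by rewrite nr_pair /= gt_max H1.
(* R2 is the remainder of the propagation of delta by the flow. *)
pose Ld (tau : R) : state := 'd F q (0, delta tau).
pose R2 (tau : R) : state := phi (t0 + s1 tau) (s2 tau) (y1 tau)
  - phi t0 (s1 tau + s2 tau) y0 - delta tau - s2 tau *: Ld tau.
have R2s : small p.+2 R2.
  have [Kd Kd0 Hd] := deltab; move=> e e0.
  have gK : 0 <= nr g2 * Kd by rewrite mulr_ge0 ?nr_ge0 // ltW.
  have e'0 : 0 < e / (1 + nr g2 * Kd) by rewrite divr_gt0 // ltr_wpDr.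
  have [r r0 H] := flow_variation openJ openV holF flow Jt0 Vy0 e'0.
  have nears : \forall tau \near (0 : R),
      nr (s1 tau) < r /\ nr (s2 tau) < r /\ nr (Y tau) < r.
    apply: (filterI (near0_scale_lt g1 r0)).
    exact: (filterI (near0_scale_lt g2 r0) (Yr r r0)).
  apply: filterS2 nears Hd => tau [H1 [H2 H3]] Hd'.
  rewrite (le_trans (H _ _ _ _ H1 H2 H3 erefl))// nr_s2.
  rewrite (@le_trans _ _ (e / (1 + nr g2 * Kd) * (nr g2 * `|tau|) * (Kd * `|tau| ^+ p.+1))) //.
    apply: ler_wpM2l => //; apply: mulr_ge0; first exact: ltW.
    by rewrite mulr_ge0 ?nr_ge0.
  have -> (A t : R) : A * (nr g2 * t) * (Kd * t ^+ p.+1) =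
      nr g2 * Kd * A * t ^+ p.+2 by rewrite [t ^+ p.+2]exprS; ring.
  by rewrite ler_wpM2r ?exprn_ge0 // mul_div_succ_le.
pose R3 (tau : R) : state := Phi (t0 + s1 tau) (s2 tau) (y1 tau)
  - (phi (t0 + s1 tau) (s2 tau) (y1 tau)
     + (c1%:C%C * s2 tau ^+ p.+1) *: F1 (t0 + s1 tau, y1 tau)
     + (c2%:C%C * s2 tau ^+ p.+2) *: F2 (t0 + s1 tau, y1 tau)).
have R3s : small p.+2 R3.
  apply: (bounded_small (ltnSn p.+2)).
  exists (1 + K * nr g2 ^+ p.+3); first by rewrite ltr_wpDr // mulr_ge0 ?exprn_ge0 ?nr_ge0 // ltW.
  have nears : \forall tau \near (0 : R),
      nr (s1 tau) < re /\ nr (s2 tau) < re /\ nr (Y tau) < re.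
    apply: (filterI (near0_scale_lt g1 re0)).
    exact: (filterI (near0_scale_lt g2 re0) (Yr re re0)).
  apply: filterS nears => tau [H1 [H2 H3]].
  have H1' : nr (t0 + s1 tau - t0) < re by rewrite [t0 + _]addrC addrK.
  apply: (le_trans (step (s2 tau) (t0 + s1 tau) (y1 tau) H2 H1' H3)).
  rewrite nr_s2 exprMn mulrA ler_wpM2r ?exprn_ge0 //.
  by rewrite lerDr.
(* R4, R5 and R6 come from evaluating F1, F2 at the state after the first step
   and the Jacobian at delta. *)
pose R4 (tau : R) : state := F1 (t0 + s1 tau, y1 tau) - F1 q - s1 tau *: d1.
have R4s : small 1 R4.
  rewrite (_ : R4 = fun tau =>
      (F1 (q + h tau) - F1 q - 'd F1 q (h tau)) + 'd F1 q (0, W tau)).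
    apply: smallD.
      have [Kh Kh0 Hh] := hb; move=> e e0.
      have e'0 : 0 < e / (1 + Kh) by rewrite divr_gt0 // addr_gt0.
      have [r r0 H] := differentiable_nr dF1 e'0.
      apply: filterS2 (hr r r0) Hh => tau /H H1 H2; apply: (le_trans H1).
      rewrite (le_trans (ler_wpM2l (ltW e'0) H2))// mulrA ler_wpM2r ?exprn_ge0 // mulrC.
      exact: mul_div_succ_le (ltW Kh0) e0.
    apply: (@small_bound _ _ _ _ (nr ('d F1 q (1, 0))
      + \sum_(k < d) nr ('d F1 q (0, delta_mx ord0 k))) W) => //.
      by rewrite addr_ge0 ?nr_ge0 // sumr_ge0 // => k _; exact: nr_ge0.
    apply: filterE => tau; rewrite (le_trans (linear_nr_le _ _))//.
    by rewrite nr_pair /= nr0 max_r // nr_ge0.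
  apply/funext => tau; rewrite /R4 qh -[RHS]addrA; congr (_ + _).
  rewrite addrC -raddfB /=.
  have -> : ((0, W tau) - h tau : R[i] * state) = - (s1 tau *: (1, F q)).
    rewrite -[LHS]opprB; congr (- _); congr (_, _); first by rewrite subr0 /= /GRing.scale /= mulr1.
    by rewrite /W /Y /= opprB addrC subrK.
  have d1Z : 'd F1 q (s1 tau *: (1, F q)) = s1 tau *: d1 by rewrite linearZ.
  by rewrite -d1Z; exact/esym/raddfN.
pose R5 (tau : R) : state := F2 (t0 + s1 tau, y1 tau) - F2 q.
have R5s : small 0 R5.
  have [K2 [K20 [r r0 H]]] := differentiable_lipschitz dF2.
  apply: (@small_bound _ _ _ _ K2 h) => //; last exact: (bounded_small _ hb).
  by apply: filterS (hr r r0) => tau /H; rewrite qh.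
pose R6 (tau : R) : state := Ld tau
  - (c1%:C%C * g1 ^+ p.+1 * tau%:C%C ^+ p.+1) *: L1.
have R6s : small p.+1 R6.
  apply: (@small_bound _ _ _ _ (nr ('d F q (1, 0))
      + \sum_(k < d) nr ('d F q (0, delta_mx ord0 k))) (fun tau =>
    (c2%:C%C * g1 ^+ p.+2 * tau%:C%C ^+ p.+2) *: F2 q + R1 tau)).
  - by rewrite addr_ge0 ?nr_ge0 // sumr_ge0 // => k _; exact: nr_ge0.
  - apply: filterE => tau.
    have -> : R6 tau = 'd F q (0, (c2%:C%C * g1 ^+ p.+2 * tau%:C%C ^+ p.+2) *: F2 q + R1 tau).
      rewrite /R6 /Ld /L1 /state_deriv -linearZ -raddfB; congr ('d F q _); congr (_, _).
        by rewrite /= scaler0 subr0.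
      by rewrite /= deltaE addrC addKr.
    rewrite (le_trans (linear_nr_le _ _))//.
    by rewrite nr_pair /= nr0 max_r // nr_ge0.
  - exact: bounded_small delta2b.
have S6 := small_scale 1 g2 R6s.
have S4 := small_scale p.+1 (c1%:C%C * g2 ^+ p.+1) R4s; rewrite addn1 in S4.
have S5 := small_scale p.+2 (c2%:C%C * g2 ^+ p.+2) R5s; rewrite addn0 in S5.
have S1 : small p.+2 R1 by exact: bounded_small (ltnSn p.+2) R1b.
have total := smallD (smallD (smallD (smallD (smallD S1 R2s) R3s) S6) S4) S5.
rewrite (_ : (fun tau : R => _) = (fun tau => R1 tau + R2 tau + R3 tau
    + (g2 * tau%:C%C ^+ 1) *: R6 tau
    + (c1%:C%C * g2 ^+ p.+1 * tau%:C%C ^+ p.+1) *: R4 tau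
    + (c2%:C%C * g2 ^+ p.+2 * tau%:C%C ^+ p.+2) *: R5 tau)) //.
apply/funext => tau.
rewrite -/(s1 tau) -/(s2 tau) -/(y1 tau) /R1 /R2 /R3 /R4 /R5 /R6 !s1E !s2E.
rewrite ![_ ^+ p.+2]exprSr /s1 /s2.
move: (Phi _ _ (y1 tau)) (phi _ _ (y1 tau)) (phi t0 _ y0) (F1 (_, _)) (F2 (_, _)).
move=> Psi phi2 phi12 F1y F2y.
move: (L1) (d1) (F1 q) (F2 q) (delta tau) (Ld tau) (tau%:C%C ^+ p.+1) (g1 ^+ p.+1) (g2 ^+ p.+1).
move=> l1 m1 F1q F2q dl Ldl T a1 a2.
by apply/rowP => k; rewrite !mxE; ring.
Qed.

End Composition.

(** * The Euclidean norm *)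

Section EuclideanNorm.
Context {R : realType} {d : nat}.
Implicit Types (z : 'rV[R[i]]_d).

Lemma enormZ (x : R) z : enorm (x%:C%C *: z) = `|x| * enorm z.
Proof.
rewrite /enorm -sqrtr_sqr -sqrtrM ?sqr_ge0 // mulr_sumr; congr Num.sqrt.
apply: eq_bigr => k _; rewrite mxE; case: (z _ _) => a b /=; ring.
Qed.

Lemma enorm_imV z : enorm (cplx (imV z)) = enorm (inonreal z).
Proof.
rewrite /enorm; congr Num.sqrt; apply: eq_bigr => k _.
by rewrite inonrealE !mxE; case: (z _ _) => a b /=; ring.
Qed.

Lemma enorm_gt0 z : z != 0 -> 0 < enorm z.
Proof.
move=> /rV0Pn[k zk]; rewrite sqrtr_gt0 lt_neqAle eq_sym.
have ge0 (j : 'I_d) : 0 <= complex.Re (z ord0 j) ^+ 2 + complex.Im (z ord0 j) ^+ 2.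
  by rewrite addr_ge0 ?sqr_ge0.
rewrite sumr_ge0 ?andbT => [|j _]; last exact: ge0.
apply: contra zk => /eqP/psumr_eq0P => /(_ (fun j _ => ge0 j) k isT) /eqP.
rewrite paddr_eq0 ?sqr_ge0 // !sqrf_eq0 => /andP[re0 im0].
by rewrite eq_complex /= re0 im0.
Qed.

Lemma enorm_cvg (Y : R -> 'rV[R[i]]_d) z :
  (forall e : R, 0 < e -> \forall tau \near (0 : R)^', nr (Y tau - z) <= e) ->
  enorm (Y tau) @[tau --> (0 : R)^'] --> enorm z.
Proof.
move=> Yz.
have cvg_l (l : 'rV[R[i]]_d -> R) : additive l -> (forall u, `|l u| <= nr u) ->
    l (Y tau) @[tau --> (0 : R)^'] --> l z.
  move=> ladd lle; apply/cvgrPdist_le => e e0.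
  apply: filterS (Yz e e0) => tau H.
  by rewrite distrC -ladd (le_trans (lle _)).
pose S (u : 'rV[R[i]]_d) : R :=
  \sum_(k < d) (complex.Re (u ord0 k) ^+ 2 + complex.Im (u ord0 k) ^+ 2).
suff cS : S (Y tau) @[tau --> (0 : R)^'] --> S z.
  by apply: continuous_cvg cS; exact: sqrt_continuous.
suff cSk k : complex.Re (Y tau ord0 k) ^+ 2 + complex.Im (Y tau ord0 k) ^+ 2
    @[tau --> (0 : R)^'] --> complex.Re (z ord0 k) ^+ 2 + complex.Im (z ord0 k) ^+ 2.
  rewrite /S; elim: (index_enum _) => [|k r IH].
    by rewrite big_nil; under eq_fun do rewrite big_nil; exact: cvg_cst.
  by rewrite big_cons; under eq_fun do rewrite big_cons; exact: cvgD.
apply: cvgD.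
- have H : complex.Re (Y tau ord0 k) @[tau --> (0 : R)^'] --> complex.Re (z ord0 k).
    apply: (cvg_l (fun u : 'rV_d => complex.Re (u ord0 k))) => [y u|u].
      by rewrite !mxE; case: (y _ _) (u _ _) => ? ? [].
    by rewrite (le_trans (nr_Re _)) // nr_coord.
  exact: (cvgM H H).
- have H : complex.Im (Y tau ord0 k) @[tau --> (0 : R)^'] --> complex.Im (z ord0 k).
    apply: (cvg_l (fun u : 'rV_d => complex.Im (u ord0 k))) => [y u|u].
      by rewrite !mxE; case: (y _ _) (u _ _) => ? ? [].
    by rewrite (le_trans (nr_Im _)) // nr_coord.
  exact: (cvgM H H).
Qed.

Lemma near_dnbhs0 (P : R -> Prop) :
  (\forall tau \near (0 : R), tau != 0 -> P tau) -> \forall tau \near (0 : R)^', P tau.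
Proof. by []. Qed.

Lemma enorm_leading m z (X : R -> 'rV[R[i]]_d) : small m X ->
  enorm (tau%:C%C ^+ m *: z + X tau) / `|tau| ^+ m @[tau --> (0 : R)^'] --> enorm z.
Proof.
move=> sX; pose Y (tau : R) := z + ((tau ^+ m)^-1)%:C%C *: X tau.
have cY : enorm (Y tau) @[tau --> (0 : R)^'] --> enorm z.
  apply: enorm_cvg => e e0; have sXe := sX e e0.
  apply: near_dnbhs0; apply: filterS sXe => tau H tau0.
  rewrite /Y addrC addKr nrZ nrR normfV normrX mulrC.
  by rewrite ler_pdivrMr // exprn_gt0 // normr_gt0.
apply: cvg_trans cY; apply: near_eq_cvg.
apply: near_dnbhs0; apply: filterE => tau tau0 /=.
have tm0 : tau ^+ m != 0 by rewrite expf_neq0.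
have -> : tau%:C%C ^+ m *: z + X tau = (tau ^+ m)%:C%C *: Y tau.
  by rewrite /Y scalerDr scalerA -rmorphM divff // scale1r rmorphXn.
by rewrite enormZ normrX mulrAC divff ?mul1r // expf_neq0 // normr_eq0.
Qed.

End EuclideanNorm.

(** * The coefficients of the composition *)

Section Coefficients.
Context {R : realType}.

(** The condition forces |g1| = |g2|, hence g1 and g2 = 1 - g1 have real part 1/2
    and are conjugate; then the n-th power of g1 is the opposite of its own
    conjugate. *)
Lemma conjugate_coefficients (g1 g2 : R[i]) n : (0 < n)%N ->
  g1 + g2 = 1 -> g1 ^+ n + g2 ^+ n = 0 ->
  exists s b : R, [/\ s != 0, b != 0, g1 = (1 / 2 +i* s)%C,
    g2 = (1 / 2 -i* s)%C & g1 ^+ n = (b%:C * 'i)%C].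
Proof.
move=> n0 g12 gn; have g2E : g2 = 1 - g1 by rewrite -g12 addrC addKr.
have g2n : g2 ^+ n = - g1 ^+ n by apply/eqP; rewrite -addr_eq0 addrC gn.
have norm12 : nr g1 = nr g2.
  apply/eqP; rewrite -(@eqrXn2 _ n) ?nr_ge0 //.
  by rewrite -!nrX g2n nrN.
case: g1 => x s in g12 gn g2E g2n norm12 *.
have {}g2E : g2 = ((1 - x) -i* s)%C by rewrite g2E; apply/eqP; rewrite eq_complex /= sub0r !eqxx.
have x2 : x = 1 / 2.
  move: norm12; rewrite g2E /nr !normc_def /= => /eqP.
  rewrite eqr_sqrt ?addr_ge0 ?sqr_ge0 // => /eqP; nra.
rewrite g2E {}x2 in g12 gn g2n norm12 *.
have half : 1 - 1 / 2 = 1 / 2 :> R by field.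
rewrite half in gn g2n g2E *.
have conjE : ((1 / 2 -i* s)%C : R[i]) = ((1 / 2 +i* s)%C)^*%C by [].
have re0 : complex.Re ((1 / 2 +i* s)%C ^+ n) = 0.
  have := congr1 (@complex.Re R) g2n; rewrite conjE -rmorphXn /=.
  by case: (_ ^+ n) => u v /=; lra.
set w := (1 / 2 +i* s)%C ^+ n in re0 g2n *.
have wE : w = ((complex.Im w)%:C * 'i)%C.
  by apply/eqP; rewrite eq_complex /= re0; apply/andP; split; apply/eqP; ring.
exists s, (complex.Im w); split => //.
- apply/eqP => s0; move: gn; rewrite s0 oppr0.
  have -> : ((1 / 2 +i* 0)%C : R[i]) = (1 / 2)%:C%C by [].
  rewrite -rmorphXn -rmorphD /= => -[] /eqP; apply/negP.
  by rewrite gt_eqF // addr_gt0 // exprn_gt0 // divr_gt0.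
- apply/eqP => w0; move: wE; rewrite w0 mul0r => /eqP.
  rewrite /w expf_eq0 n0 /= eq_complex /= => /andP[/eqP half0 _].
  by move: half0; clear; lra.
Qed.

End Coefficients.

(** * Asymptotic equivalence of the two norms *)

Lemma equiv_leading (R : realType) (f g : R -> R) m (a b : R) : 0 < a -> 0 < b ->
  f tau / `|tau| ^+ m @[tau --> (0 : R)^'] --> a ->
  g tau / `|tau| ^+ m @[tau --> (0 : R)^'] --> b ->
  f ~_ (0^') (fun tau => a / b * g tau).
Proof.
move=> a0 b0 fa gb; apply/eqaddoP => e e0.
have ha : 0 < a / 2 by rewrite divr_gt0.
have hea : 0 < e * (a / 2) / 2 by rewrite divr_gt0 // mulr_gt0.
have cga : a / b * (g tau / `|tau| ^+ m) @[tau --> (0 : R)^'] --> a.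
  rewrite -[X in _ --> X](divfK (lt0r_neq0 b0)).
  by apply: cvgM => //; exact: cvg_cst.
have near1 : \forall tau \near (0 : R)^', tau != 0.
  by apply: near_dnbhs0; exact: filterE.
have near2 : \forall tau \near (0 : R)^', `|a - f tau / `|tau| ^+ m| < e * (a / 2) / 2.
  by move/cvgrPdist_lt: fa; apply.
have near3 : \forall tau \near (0 : R)^',
    `|a - a / b * (g tau / `|tau| ^+ m)| < Num.min (e * (a / 2) / 2) (a / 2).
  by move/cvgrPdist_lt: cga; apply; rewrite lt_min hea.
apply: filterS3 near1 near2 near3 => tau tau0.
have T0 : 0 < `|tau| ^+ m by rewrite exprn_gt0 // normr_gt0.
rewrite /= !fctE mulrA; set G := a / b * g tau; set T := `|tau| ^+ m in T0 *.
rewrite lt_min => H1 /andP[H2 H3].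
have Tn0 : T != 0 by rewrite gt_eqF.
rewrite -(ler_pM2r (_ : 0 < T^-1)) ?invr_gt0 // -[T^-1]gtr0_norm ?invr_gt0 //.
rewrite -mulrA -!normrM mulrBl.
have : a / 2 <= `|G / T| by move: H3; rewrite !ltr_norml !ler_normr; lra.
move=> /(ler_wpM2l (ltW e0)); apply: le_trans.
by move: H1 H2; rewrite !ltr_norml ler_norml; lra.
Qed.

Theorem theorem2 (R : realType) (d p : nat)
  (I : set R) (U : set 'rV[R]_d) (J : set R[i]) (V : set 'rV[R[i]]_d)
  (f : R * 'rV[R]_d -> 'rV[R]_d)
  (fC F1 F2 : R[i] * 'rV[R[i]]_d -> 'rV[R[i]]_d)
  (phi Phi : R[i] -> R[i] -> 'rV[R[i]]_d -> 'rV[R[i]]_d)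
  (c1 c2 : R) (gamma1 gamma2 : R[i]) (tn : R) (yn : 'rV[R]_d) :
  open I -> open U -> open J -> open V ->
  (forall t, I t -> J t%:C%C) -> (forall y, U y -> V (cplx y)) ->
  (forall t y, I t -> U y -> fC (t%:C%C, cplx y) = cplx (f (t, y))) ->
  holomorphic_on (J `*` V) fC ->
  holomorphic_on (J `*` V) F1 -> real_on I U F1 ->
  holomorphic_on (J `*` V) F2 -> real_on I U F2 ->
  exact_flow J V fC phi ->
  method_order p J V phi Phi c1 c2 F1 F2 ->
  I tn -> U yn ->
  gamma1 + gamma2 = 1 ->
  gamma1 ^+ p.+1 + gamma2 ^+ p.+1 = 0 ->
  let Psi (tau : R) : 'rV[R[i]]_d :=
    Phi (tn%:C%C + gamma1 * tau%:C%C) (gamma2 * tau%:C%C)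
      (Phi tn%:C%C (gamma1 * tau%:C%C) (cplx yn)) in
  re_nondegenerate fC c1 c2 F1 F2 (tn%:C%C, cplx yn) ->
  im_nondegenerate fC c1 F1 (tn%:C%C, cplx yn) ->
  exists C : R,
    (fun tau : R =>
       enorm (phi tn%:C%C tau%:C%C (cplx yn) - cplx (reV (Psi tau))))
    ~_ (0^') (fun tau : R => C * enorm (cplx (imV (Psi tau)))).
Proof.
move=> oI oU oJ oV IJ UV fCreal holf hol1 real1 hol2 real2 flow order Itn Uyn.
move=> g12 gp Psi reN imN.
(* For p = 0 the two conditions on gamma1 + gamma2 contradict each other. *)
have p0 : (0 < p)%N.
  by case: (p) gp => //; rewrite !expr1 g12 => /eqP; rewrite oner_eq0.
have [s [b [s0 b0 g1E g2E g1p]]] := conjugate_coefficients (ltn0Sn p) g12 gp.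
have g2p : gamma2 ^+ p.+1 = - (b%:C * 'i)%C.
  by apply/eqP; rewrite -addr_eq0 -g1p addrC gp.
have Jtn := IJ tn Itn; have Vyn := UV yn Uyn.
have realf : real_on I U fC by move=> t y It Uy; exists (f (t, y)); exact: fCreal.
set q : R[i] * 'rV[R[i]]_d := (tn%:C%C, cplx yn).
pose S := state_deriv fC F1 q; pose Fl := flow_deriv fC F1 q.
pose A := c1%:C%C *: (Fl + S) - (2 * c2)%:C%C *: F2 q.
pose B := c1%:C%C *: (Fl - S).
have An0 : A != 0 by exact: reN.
have Bn0 : B != 0 by exact: imN.
have JVq : (J `*` V) q by [].
have [[vf fq] [v1 F1q] [v2 F2q]] := And3 (realf tn yn Itn Uyn)
  (real1 tn yn Itn Uyn) (real2 tn yn Itn Uyn).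
have realS : inonreal S = 0.
  rewrite /S /state_deriv F1q.
  by apply: (@real_diff R d I U fC tn yn 0 v1) => //; exact: (holf q JVq).1.
have realFl : inonreal Fl = 0.
  rewrite /Fl /flow_deriv fq.
  by apply: (@real_diff R d I U F1 tn yn 1 vf) => //; exact: (hol1 q JVq).1.
have realA : inonreal A = 0.
  rewrite /A inonrealB !inonrealZ inonrealD realS realFl F2q inonreal_cplx.
  by rewrite addr0 !scaler0 subr0.
have realB : inonreal B = 0.
  by rewrite /B inonrealZ inonrealB realS realFl subr0 scaler0.
(* Er is real and Ei is purely imaginary: they are the real and imaginary parts
   of the coefficient of tau^(p+2) in Psi tau - phi tau. *)
pose Er := (s * b)%:C%C *: A; pose Ei := ((- (b / 2)) *i)%C *: B.
have realEr : inonreal Er = 0 by rewrite inonrealZ realA scaler0.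
have imEi : inonreal Ei = Ei by exact: inonreal_imaginary realB.
pose m := p.+2.
pose X (tau : R) := Psi tau - (phi tn%:C%C tau%:C%C (cplx yn)
  + tau%:C%C ^+ m *: (Er + Ei)).
have Xs : small m X.
  have := composition_expansion oJ oV holf hol1 hol2 flow order Jtn Vyn gamma1 gamma2 p0.
  congr small; apply/funext => tau; rewrite gp !mulr0 scale0r addr0 -mulrDl g12 mul1r.
  rewrite -/(Psi tau) /X; congr (_ - (_ + _ *: _)).
  rewrite ![_ ^+ p.+2]exprSr g1p g2p -/q -/S -/Fl /Er /Ei /A /B.
  rewrite g1E g2E; move: (S) (Fl) (F2 q) => S' Fl' F2'; clear.
  apply/rowP => k; rewrite !mxE.
  move: (S' _ _) (Fl' _ _) (F2' _ _) => -[xs ys] [xf yf] [x2 y2].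
  by apply/eqP; rewrite eq_complex /=; apply/andP; split; apply/eqP; field.
have phi_real : \forall tau \near (0 : R)^',
    inonreal (phi tn%:C%C tau%:C%C (cplx yn)) = 0.
  apply: near_dnbhs0.
  by apply: filterS (flow_real oJ oV holf flow oI oU Itn Uyn Jtn Vyn realf) => tau ->.
pose Xi (tau : R) := inonreal (X tau).
have Xis : small m Xi.
  by apply: (@small_bound R _ _ _ 1 X) => //; apply: filterE => tau; rewrite mul1r nr_inonreal.
have XXs : small m (fun tau => Xi tau - X tau).
  apply: smallD => //.
  by apply: (@small_bound R _ _ _ 1 X) => //; apply: filterE => tau; rewrite mul1r nrN.
have PsiE (tau : R) : Psi tau = phi tn%:C%C tau%:C%C (cplx yn)
    + (tau%:C%C ^+ m *: (Er + Ei) + X tau) by rewrite /X addrA [RHS]addrC subrK.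
have imE (tau : R) : inonreal (phi tn%:C%C tau%:C%C (cplx yn)) = 0 ->
    inonreal (Psi tau) = tau%:C%C ^+ m *: Ei + Xi tau.
  move=> phi0; rewrite PsiE inonrealD phi0 add0r inonrealD; congr (_ + _).
  have -> : tau%:C%C ^+ m = (tau ^+ m)%:C%C by exact/esym/rmorphXn.
  rewrite inonrealZ; congr (_ *: _).
  by rewrite inonrealD realEr add0r.
have reE : forall tau : R, inonreal (phi tn%:C%C tau%:C%C (cplx yn)) = 0 ->
    phi tn%:C%C tau%:C%C (cplx yn) - cplx (reV (Psi tau)) =
    tau%:C%C ^+ m *: (- Er) + (Xi tau - X tau).
  move=> tau phi0.
  have -> : cplx (reV (Psi tau)) = Psi tau - inonreal (Psi tau).
    by rewrite /inonreal subKr.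
  rewrite (imE tau phi0) [in LHS]PsiE.
  by apply/rowP => k; rewrite !mxE; ring.
have aE : 0 < enorm (- Er).
  apply: enorm_gt0; rewrite oppr_eq0 /Er scaler_eq0 negb_or An0 andbT.
  by rewrite eq_complex /= eqxx andbT mulf_neq0.
have bE : 0 < enorm Ei.
  apply: enorm_gt0; rewrite /Ei scaler_eq0 negb_or Bn0 andbT.
  have b20 : - (b / 2) != 0 by rewrite oppr_eq0 mulf_neq0 // invr_neq0.
  by rewrite eq_complex /= (negbTE b20) andbF.
exists (enorm (- Er) / enorm Ei); apply: (@equiv_leading R _ _ m _ _ aE bE).
- apply: cvg_trans (@enorm_leading _ _ m (- Er) _ XXs); apply: near_eq_cvg.
  by apply: filterS phi_real => tau phi0; rewrite reE.
- apply: cvg_trans (@enorm_leading _ _ m Ei _ Xis); apply: near_eq_cvg.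
  by apply: filterS phi_real => tau phi0; rewrite enorm_imV imE.
Qed.
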